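(* Let $X$ be an uncountable set. Let $E=(E^0,E^1,d,r)$ be the discrete graph in which $E^0$ is the set of all finite subsets of $X$, $E^1=\{(x;v)\mid v\in E^0,\ x\in v\}$, $d((x;v))=v$ and $r((x;v))=v\setminus\{x\}$ (both $E^0$ and $E^1$ carry the discrete topology). Then the $C^*$-algebra $\mathcal{O}(E)$ is an inductive limit (over a directed set) of finite dimensional $C^*$-algebras.
   Context: A topological graph $E=(E^0,E^1,d,r)$ consists of two locally compact Hausdorff spaces $E^0,E^1$, a local homeomorphism $d\colon E^1\to E^0$ and a continuous map $r\colon E^1\to E^0$; a discrete graph is one with $E^0,E^1$ discrete. Put $E^0_{\rm sce}=E^0\setminus\overline{r(E^1)}$, $E^0_{\rm fin}=\{v\in E^0: v$ has a neighborhood $V$ with $r^{-1}(V)$ compact$\}$, $E^0_{\rm rg}=E^0_{\rm fin}\setminus\overline{E^0_{\rm sce}}$ (for a discrete graph, $E^0_{\rm rg}=\{v: 0<|r^{-1}(v)|<\infty\}$). $C_d(E^1)$ is the set of continuous functions $\xi$ on $E^1$ such that $\langle\xi,\xi\rangle(v)=\sum_{e\in d^{-1}(v)}|\xi(e)|^2<\infty$ for all $v$ and $\langle\xi,\xi\rangle\in C_0(E^0)$. It is a Hilbert $C_0(E^0)$-module with $(\xi f)(e)=\xi(e)f(d(e))$, $\langle\xi,\eta\rangle(v)=\sum_{e\in d^{-1}(v)}\overline{\xi(e)}\eta(e)$, and has a left action $(\pi_r(f)\xi)(e)=f(r(e))\xi(e)$ of $C_0(E^0)$; $\pi_r(C_0(E^0_{\rm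 rg}))\subset\mathcal{K}(C_d(E^1))$. A Toeplitz $E$-pair on a $C^*$-algebra $A$ is a pair $T=(T^0,T^1)$ of a $*$-homomorphism $T^0\colon C_0(E^0)\to A$ and a linear map $T^1\colon C_d(E^1)\to A$ with $T^1(\xi)^*T^1(\eta)=T^0(\langle\xi,\eta\rangle)$ and $T^0(f)T^1(\xi)=T^1(\pi_r(f)\xi)$. It is a Cuntz-Krieger $E$-pair if $T^0(f)=\varPhi(\pi_r(f))$ for all $f\in C_0(E^0_{\rm rg})$, where $\varPhi\colon\mathcal{K}(C_d(E^1))\to A$ is the $*$-homomorphism with $\varPhi(\theta_{\xi,\eta})=T^1(\xi)T^1(\eta)^*$. $\mathcal{O}(E)$ is the $C^*$-algebra generated by the universal Cuntz-Krieger $E$-pair $t=(t^0,t^1)$. *)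

(* Defs.v *)
From HB Require Import structures.
From mathcomp Require Import all_boot all_order all_algebra finmap complex.
From mathcomp Require Import all_classical all_reals all_analysis.
From mathcomp Require summability.

Set Implicit Arguments.
Unset Strict Implicit.
Unset Printing Implicit Defensive.
Import Order.TTheory GRing.Theory Num.Theory numFieldNormedType.Exports.
Local Open Scope classical_set_scope.
Local Open Scope ring_scope.

(* The type [R[i]] carries no topology of its own; packing it as an element of
   [numClosedFieldType] gives access to the canonical topology of number
   fields. *)
Definition Cplx (R : realType) : numClosedFieldType := R[i].

(* The norm [`|z|] of MathComp lives in [Cplx R]; this is its value in [R]. *)
Definition cabs (R : realType) (z : Cplx R) : R := complex.Re `|z|.

HB.mixin Record CompleteNormedModule_isCStarAlgebra (R : realType) A
    & CompleteNormedModule (Cplx R) A := {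
  cmul : A -> A -> A;
  cstar : A -> A;
  cmulA : forall x y z, cmul x (cmul y z) = cmul (cmul x y) z;
  cmulDl : forall x y z, cmul (x + y) z = cmul x z + cmul y z;
  cmulDr : forall x y z, cmul x (y + z) = cmul x y + cmul x z;
  cscalerAl : forall (a : Cplx R) x y, a *: cmul x y = cmul (a *: x) y;
  cscalerAr : forall (a : Cplx R) x y, a *: cmul x y = cmul x (a *: y);
  cstarK : forall x, cstar (cstar x) = x;
  cstarD : forall x y, cstar (x + y) = cstar x + cstar y;
  cstarZ : forall (a : Cplx R) x, cstar (a *: x) = a^* *: cstar x;
  cstarM : forall x y, cstar (cmul x y) = cmul (cstar y) (cstar x);
  cnorm_mul_le : forall x y, `|cmul x y| <= `|x| * `|y|;
  cnorm_star_mul : forall x, `|cmul (cstar x) x| = `|x| ^+ 2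
}.

#[short(type="cstarAlgType")]
HB.structure Definition CStarAlgebra (R : realType) :=
  {A of CompleteNormedModule (Cplx R) A
      & CompleteNormedModule_isCStarAlgebra R A}.

Section CStar.
Context {R : realType}.
Local Notation C := (Cplx R).

Record star_hom (A B : cstarAlgType R) (f : A -> B) : Prop := StarHom {
  star_hom_linear : forall (a : C) x y, f (a *: x + y) = a *: f x + f y;
  star_hom_mul : forall x y, f (cmul x y) = cmul (f x) (f y);
  star_hom_star : forall x, f (cstar x) = cstar (f x)
}.

Record star_subalgebra (A : cstarAlgType R) (S : set A) : Prop :=
  StarSubalgebra {
    star_subalgebra0 : S 0;
    star_subalgebra_linear :
      forall (a : C) x y, S x -> S y -> S (a *: x + y);
    star_subalgebra_mul : forall x y, S x -> S y -> S (cmul x y);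
    star_subalgebra_star : forall x, S x -> S (cstar x)
  }.

Definition finite_dimensional (A : cstarAlgType R) : Prop :=
  exists (n : nat) (b : 'I_n -> A),
    forall x, exists c : 'I_n -> C, x = \sum_(i < n) c i *: b i.

(* The connecting map [dsys_map i j] is meaningful only when [dsys_le i j]. *)
Record directed_system := DirectedSystem {
  dsys_index : Type;
  dsys_le : dsys_index -> dsys_index -> Prop;
  dsys_inhabited : inhabited dsys_index;
  dsys_refl : forall i, dsys_le i i;
  dsys_trans : forall i j k, dsys_le i j -> dsys_le j k -> dsys_le i k;
  dsys_directed : forall i j, exists k, dsys_le i k /\ dsys_le j k;
  dsys_alg :> dsys_index -> cstarAlgType R;
  dsys_map : forall i j, dsys_alg i -> dsys_alg j;
  dsys_map_hom : forall i j, dsys_le i j -> star_hom (@dsys_map i j);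
  dsys_map_id : forall i x, @dsys_map i i x = x;
  dsys_map_comp : forall i j k, dsys_le i j -> dsys_le j k ->
    forall x, @dsys_map j k (@dsys_map i j x) = @dsys_map i k x
}.

Definition cocone (S : directed_system) (B : cstarAlgType R)
    (psi : forall i, S i -> B) : Prop :=
  (forall i, star_hom (psi i)) /\
  (forall i j, dsys_le i j -> forall x, psi j (dsys_map j x) = psi i x).

(* [A] is the colimit of [S] in the category of C*-algebras and
   *-homomorphisms. *)
Definition inductive_limit (S : directed_system) (A : cstarAlgType R) : Prop :=
  exists psi : forall i, S i -> A,
    cocone psi /\
    forall (B : cstarAlgType R) (chi : forall i, S i -> B), cocone chi ->
      exists! h : A -> B,
        star_hom h /\ forall i x, h (psi i x) = chi i x.

End CStar.

Arguments directed_system : clear implicits.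

Definition local_homeomorphism (S T : topologicalType) (f : S -> T) : Prop :=
  forall x, exists U : set S,
    [/\ open U, U x, open (f @` U), {within U, continuous f} &
        exists g : T -> S,
          {within f @` U, continuous g} /\ {in U, cancel f g}].

Record topological_graph := TopologicalGraph {
  vertex : topologicalType;
  edge : topologicalType;
  dmap : edge -> vertex;
  rmap : edge -> vertex;
  vertex_hausdorff : hausdorff_space vertex;
  vertex_locally_compact : locally_compact [set: vertex];
  edge_hausdorff : hausdorff_space edge;
  edge_locally_compact : locally_compact [set: edge];
  dmap_local_homeo : local_homeomorphism dmap;
  rmap_continuous : continuous rmap
}.

Section GraphSets.
Variable E : topological_graph.

Definition E0sce : set (vertex E) := ~` closure (range (@rmap E)).

Definition E0fin : set (vertex E) :=
  [set v | exists2 V, nbhs v V & compact (@rmap E @^-1` V)].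

Definition E0rg : set (vertex E) := E0fin `\` closure E0sce.

End GraphSets.

Section GraphAlgebra.
Context {R : realType}.
Local Notation C := (Cplx R).

Definition C0 (V : topologicalType) : set (V -> C) :=
  [set f | continuous f /\
           forall eps : R, 0 < eps -> compact [set v | eps <= cabs (f v)]].

(* $C_0(U)$ for an open subset [U] of [V], seen inside $C_0(V)$. *)
Definition C0_on (V : topologicalType) (U : set V) : set (V -> C) :=
  [set f | C0 f /\ forall v, ~ U v -> f v = 0].

Definition sup_norm (V : Type) (f : V -> C) : R :=
  sup (range (fun v => cabs (f v))).

Section Graph.
Variable E : topological_graph.
Local Notation E0 := (vertex E).
Local Notation E1 := (edge E).

Definition dfiber (v : E0) : set E1 := @dmap E @^-1` [set v].

(* $\langle\xi,\eta\rangle(v)$, as an unordered sum: the limit of the finite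
   partial sums of the family extended by 0 outside the fiber of [v]. *)
Definition inner (xi eta : E1 -> C) (v : E0) : C :=
  summability.sum (patch (fun=> 0) (dfiber v) (fun e => (xi e)^* * eta e)).

Definition Cd : set (E1 -> C) :=
  [set xi | [/\ continuous xi,
                forall v, (\esum_(e in dfiber v) (cabs (xi e) ^+ 2)%:E < +oo)%E
              & C0 (inner xi xi)]].

Definition Cd_norm (xi : E1 -> C) : R := Num.sqrt (sup_norm (inner xi xi)).

(* Operators on $C_d(E^1)$ are represented by total maps vanishing outside
   [Cd], so that two operators are equal as soon as they agree on [Cd]. *)
Definition operator : Type := (E1 -> C) -> (E1 -> C).

Definition on_Cd (x : operator) : operator := patch (fun=> 0) Cd x.

Definition adjoint (x y : operator) : Prop :=
  forall xi eta, Cd xi -> Cd eta -> inner (x xi) eta = inner xi (y eta).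

Definition adjointable : set operator :=
  [set x | [/\ on_Cd x = x,
               forall xi, Cd xi -> Cd (x xi)
             & exists y, (forall xi, Cd xi -> Cd (y xi)) /\ adjoint x y]].

Definition pi_r (f : E0 -> C) : operator :=
  on_Cd (fun xi e => f (rmap e) * xi e).

(* $\theta_{\xi,\eta}(\zeta) = \xi\langle\eta,\zeta\rangle$ *)
Definition theta (xi eta : E1 -> C) : operator :=
  on_Cd (fun zeta e => xi e * inner eta zeta (dmap e)).

(* $\mathcal{K}(C_d(E^1))$: the adjointable operators in the operator-norm
   closure of the linear span of the [theta xi eta]; since [Cd] is stable under
   scaling, sums of such operators suffice. *)
Definition compact_operators : set operator :=
  [set x | adjointable x /\
     forall eps : R, 0 < eps ->
       exists (n : nat) (xi eta : 'I_n -> E1 -> C),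
         (forall i, Cd (xi i) /\ Cd (eta i)) /\
         forall zeta, Cd zeta ->
           Cd_norm (x zeta - (\sum_(i < n) theta (xi i) (eta i)) zeta)
             <= eps * Cd_norm zeta].

(* A map out of $C_0(E^0)$, $C_d(E^1)$ or $\mathcal{K}(C_d(E^1))$ is given by a
   total map on functions or operators; only its values on [C0], [Cd] or
   [compact_operators] matter. *)
Section Pairs.
Variable A : cstarAlgType R.

Record C0_star_hom (T0 : (E0 -> C) -> A) : Prop := C0StarHom {
  C0_star_hom_linear : forall (a : C) f g, C0 f -> C0 g ->
    T0 (a *: f + g) = a *: T0 f + T0 g;
  C0_star_hom_mul : forall f g, C0 f -> C0 g ->
    T0 (f \* g) = cmul (T0 f) (T0 g);
  C0_star_hom_star : forall f, C0 f ->
    T0 (fun v => (f v)^*) = cstar (T0 f)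
}.

Record compact_star_hom (Phi : operator -> A) : Prop := CompactStarHom {
  compact_star_hom_linear : forall (a : C) x y,
    compact_operators x -> compact_operators y ->
    Phi (a *: x + y) = a *: Phi x + Phi y;
  compact_star_hom_mul : forall x y,
    compact_operators x -> compact_operators y ->
    Phi (x \o y) = cmul (Phi x) (Phi y);
  compact_star_hom_star : forall x y,
    compact_operators x -> compact_operators y -> adjoint x y ->
    Phi y = cstar (Phi x)
}.

Record toeplitz_pair (T0 : (E0 -> C) -> A) (T1 : (E1 -> C) -> A) : Prop :=
  ToeplitzPair {
    toeplitz_hom : C0_star_hom T0;
    toeplitz_linear : forall (a : C) xi eta, Cd xi -> Cd eta ->
      T1 (a *: xi + eta) = a *: T1 xi + T1 eta;
    toeplitz_inner : forall xi eta, Cd xi -> Cd eta ->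
      cmul (cstar (T1 xi)) (T1 eta) = T0 (inner xi eta);
    toeplitz_left : forall f xi, C0 f -> Cd xi ->
      cmul (T0 f) (T1 xi) = T1 (pi_r f xi)
  }.

Definition cuntz_krieger_pair
    (T0 : (E0 -> C) -> A) (T1 : (E1 -> C) -> A) : Prop :=
  toeplitz_pair T0 T1 /\
  exists Phi : operator -> A,
    [/\ compact_star_hom Phi,
        forall xi eta, Cd xi -> Cd eta ->
          Phi (theta xi eta) = cmul (T1 xi) (cstar (T1 eta))
      & forall f, C0_on (@E0rg E) f -> T0 f = Phi (pi_r f)].

Definition generated_by
    (T0 : (E0 -> C) -> A) (T1 : (E1 -> C) -> A) : Prop :=
  forall S : set A, closed S -> star_subalgebra S ->
    (forall f, C0 f -> S (T0 f)) -> (forall xi, Cd xi -> S (T1 xi)) ->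
    S = setT.

End Pairs.

Record graph_cstar_algebra (O : cstarAlgType R)
    (t0 : (E0 -> C) -> O) (t1 : (E1 -> C) -> O) : Prop :=
  GraphCStarAlgebra {
    graph_algebra_pair : cuntz_krieger_pair t0 t1;
    graph_algebra_generated : generated_by t0 t1;
    graph_algebra_universal : forall (B : cstarAlgType R)
        (T0 : (E0 -> C) -> B) (T1 : (E1 -> C) -> B),
      cuntz_krieger_pair T0 T1 ->
      exists rho : O -> B,
        [/\ star_hom rho,
            forall f, C0 f -> rho (t0 f) = T0 f
          & forall xi, Cd xi -> rho (t1 xi) = T1 xi]
  }.

End Graph.
End GraphAlgebra.

Section DiscreteGraph.

Lemma discrete_locally_compact (T : discreteTopologicalType) :
  locally_compact [set: T].
Proof.
move=> x _; rewrite withinET; exists [set x]; first exact: discrete_set1.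
split; [exact: compact_set1|exact: discrete_closed].
Qed.

Lemma discrete_continuous (S : discreteTopologicalType) (T : topologicalType)
  (f : S -> T) : continuous f.
Proof.
move=> x A /nbhs_singleton Afx.
by apply: filterS (discrete_set1 x) => _ ->.
Qed.

Lemma discrete_local_homeomorphism (S T : discreteTopologicalType)
  (f : S -> T) : local_homeomorphism f.
Proof.
move=> x; exists [set x]; split.
- exact: discrete_open.
- by [].
- exact: discrete_open.
- exact/continuous_subspaceT/discrete_continuous.
- exists (fun=> x); split; last by move=> y; rewrite inE => ->.
  exact/continuous_subspaceT/discrete_continuous.
Qed.

Definition discrete_graph (V W : choiceType) (d r : W -> V) :
    topological_graph :=
  let V' : discreteTopologicalType := discrete_topology V in
  let W' : discreteTopologicalType := discrete_topology W in
  @TopologicalGraph V' W' d r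
    (@discrete_hausdorff V') (@discrete_locally_compact V')
    (@discrete_hausdorff W') (@discrete_locally_compact W')
    (@discrete_local_homeomorphism W' V' d)
    (@discrete_continuous W' V' r).

End DiscreteGraph.

Section FinsetGraph.
Variable X : choiceType.

Definition finset_edge := {xv : X * {fset X} | xv.1 \in xv.2}.

Definition finset_d (e : finset_edge) : {fset X} := (val e).2.

Definition finset_r (e : finset_edge) : {fset X} :=
  ((val e).2 `\ (val e).1)%fset.

Definition finset_graph : topological_graph :=
  discrete_graph finset_d finset_r.

End FinsetGraph.

(* Main.v *)
(* Write p_v and s_e for the images of the point masses at a vertex v and an
   edge e. Since the range of an edge is its source with one point removed, there
   are only finitely many nonzero words s_mu p_v with v contained in a given finite
   set F, and the elements (s_mu p_v)(s_nu p_v)^* with v contained in F are, up to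
   0, closed under product and adjoint. They span a finite dimensional
   C*-subalgebra A_F; the A_F increase with F and have dense union.

   A dense directed union is an inductive limit because *-homomorphisms are
   bounded. Without spectral theory this is obtained as follows: for self-adjoint x
   with norm at most 1/2, a fixed point iteration gives s with
   (1 + s)^2 = 1 - x^2, and w = s - ix satisfies w^*w + w + w^* = 0. This
   equation is preserved by *-homomorphisms and forces the norm of w to be at most
   2. The same argument inside C_0(E^0) bounds t^0. *)
From HB Require Import structures.
Require Import Defs.
From mathcomp Require Import all_boot all_order all_algebra finmap complex.
From mathcomp Require Import all_classical all_reals all_analysis.
From mathcomp Require Import ring lra.
From mathcomp Require summability.

Set Implicit Arguments.
Unset Strict Implicit.
Unset Printing Implicit Defensive.
Import Order.TTheory GRing.Theory Num.Theory numFieldNormedType.Exports.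
Local Open Scope classical_set_scope.
Local Open Scope ring_scope.

(** * Norms with real values *)

Section RealNorm.
Context {R : realType}.
Local Notation C := (Cplx R).

Definition rc (x : R) : C := real_complex R x.

Lemma rc_le (x y : R) : (rc x <= rc y) = (x <= y).
Proof. exact: lecR. Qed.

Lemma rc_lt (x y : R) : (rc x < rc y) = (x < y).
Proof. exact: ltcR. Qed.

Lemma rcD (x y : R) : rc (x + y) = rc x + rc y.
Proof. by rewrite /rc rmorphD. Qed.

Lemma rcN (x : R) : rc (- x) = - rc x.
Proof. by rewrite /rc rmorphN. Qed.

Lemma rcM (x y : R) : rc (x * y) = rc x * rc y.
Proof. by rewrite /rc rmorphM. Qed.

Lemma rc0 : rc 0 = 0. Proof. by []. Qed.
Lemma rc1 : rc 1 = 1. Proof. by []. Qed.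

Lemma rcX2 (x : R) : rc (x ^+ 2) = rc x ^+ 2.
Proof. by rewrite !expr2 rcM. Qed.

Lemma rcI (x y : R) : rc x = rc y -> x = y.
Proof. by move=> []. Qed.

(** Positivity in the partial order of [C] forces the imaginary part to vanish. Radii of balls,
    which live in [C], can thus be replaced by real ones. *)
Lemma rc_gt0P (e : C) : 0 < e -> exists2 r : R, 0 < r & e = rc r.
Proof.
move=> e0; have er : e = rc (complex.Re e).
  by rewrite /rc RRe_real//; apply: gtr0_real.
by exists (complex.Re e) => //; rewrite -rc_lt -er.
Qed.

Lemma rc_conj (x : R) : (rc x)^* = rc x.
Proof. exact: conjc_real. Qed.

(** A real-valued copy of the norm puts all estimates within reach of [lra] and [nra]. *)
Definition nrm (V : normedModType C) (x : V) : R := complex.Re `|x|.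

Section NormedModule.
Variable V : normedModType C.
Implicit Types x y z : V.

Lemma nrmE x : `|x| = rc (nrm x).
Proof. by rewrite /rc /nrm RRe_real//; apply: ger0_real. Qed.

Lemma nrm_ge0 x : 0 <= nrm x.
Proof. by rewrite -rc_le -nrmE; exact: normr_ge0. Qed.

Lemma nrm0 : nrm (0 : V) = 0.
Proof. by rewrite /nrm normr0. Qed.

Lemma nrm_eq0 x : nrm x = 0 -> x = 0.
Proof. by move=> x0; apply: normr0_eq0; rewrite nrmE x0. Qed.

Lemma nrmN x : nrm (- x) = nrm x.
Proof. by rewrite /nrm normrN. Qed.

Lemma nrmBC x y : nrm (x - y) = nrm (y - x).
Proof. by rewrite -nrmN opprB. Qed.

Lemma nrmD x y : nrm (x + y) <= nrm x + nrm y.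
Proof. by rewrite -rc_le rcD -!nrmE ler_normD. Qed.

Lemma nrm_dist z x y : nrm (x - y) <= nrm (x - z) + nrm (z - y).
Proof. by have := nrmD (x - z) (z - y); rewrite addrA subrK. Qed.

Lemma cabsE (a : C) : `|a| = rc (cabs a).
Proof. by rewrite /rc /cabs RRe_real//; apply: ger0_real. Qed.

Lemma nrmZ (a : C) x : nrm (a *: x) = cabs a * nrm x.
Proof. by apply: rcI; rewrite rcM -!nrmE -cabsE normrZ. Qed.

Lemma nrm_small x : (forall e : R, 0 < e -> nrm x <= e) -> x = 0.
Proof.
move=> h; apply: nrm_eq0; apply/eqP; rewrite eq_le nrm_ge0 andbT leNgt.
by apply/negP => x0; have := h (nrm x / 2) ltac:(lra); lra.
Qed.

Lemma ball_nrm x (e : R) : ball x (rc e) = [set y | nrm (x - y) < e].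
Proof.
by rewrite -ball_normE; apply/seteqP; split=> y /=; rewrite nrmE rc_lt.
Qed.

Lemma closedP_nrm (S : set V) :
  closed S <->
  forall x, (forall e : R, 0 < e -> exists2 y, S y & nrm (x - y) < e) -> S x.
Proof.
split=> [cS x h|h x clx].
  apply: cS => B /nbhs_ballP [e /= e0 eB].
  have [r r0 er] := rc_gt0P e0.
  have [y Sy xy] := h r r0; exists y; split => //.
  by apply: eB; rewrite er ball_nrm.
apply: h => e e0.
have /clx [y [Sy]] : nbhs x (ball x (rc e)).
  by apply: nbhsx_ballx; rewrite -rc0 rc_lt.
by rewrite ball_nrm; exists y.
Qed.

End NormedModule.

Lemma nrm_complete (V : completeNormedModType C) (u : nat -> V) :
  (forall e : R, 0 < e -> exists N, forall m n, (N <= m)%N -> (N <= n)%N ->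
     nrm (u m - u n) < e) ->
  exists l, forall e : R, 0 < e -> exists N, forall n, (N <= n)%N ->
     nrm (l - u n) < e.
Proof.
move=> h.
have : cauchy (u @ \oo).
  apply: cauchy_exP => e e0; have [r r0 er] := rc_gt0P e0.
  have [N hN] := h r r0.
  exists (u N); rewrite er ball_nrm.
  by exists N => // n /= Nn; apply: hN.
move=> /cauchy_cvg /cvg_ex [l ul]; exists l => e e0.
have : nbhs l (ball l (rc e)) by apply: nbhsx_ballx; rewrite -rc0 rc_lt.
move=> /ul [N _ hN]; exists N => n /hN /=.
by rewrite ball_nrm.
Qed.

End RealNorm.

(** * Boundedness of star homomorphisms *)

Section CStarFacts.
Context {R : realType}.
Local Notation C := (Cplx R).

Lemma cabs_rc (r : R) : cabs (rc r) = `|r|.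
Proof.
apply: rcI; rewrite -cabsE; case: (leP 0 r) => r0.
  by rewrite !ger0_norm// -rc0 rc_le.
by rewrite !ltr0_norm// ?rcN// -rc0 rc_lt.
Qed.

Lemma cabs_ge0 (a : C) : 0 <= cabs a.
Proof. by rewrite -rc_le -cabsE; exact: normr_ge0. Qed.

Lemma cabsM (a b : C) : cabs (a * b) = cabs a * cabs b.
Proof. by apply: rcI; rewrite rcM -!cabsE normrM. Qed.

Lemma cabs_i : cabs ('i : C) = 1.
Proof. by apply: rcI; rewrite -cabsE normCi. Qed.

Lemma cabs0 : cabs (0 : C) = 0.
Proof. by rewrite /cabs normr0. Qed.

Lemma exprV2_small (e : R) : 0 < e -> exists N, forall n, (N <= n)%N -> 2^-1 ^+ n < e.
Proof.
move=> e0; exists (Num.bound e^-1) => n Nn.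
have n1 : 2^-1 ^+ n <= (n.+1%:R)^-1 :> R.
  rewrite exprVn lef_pV2 ?posrE ?exprn_gt0 ?ltr0n//.
  by rewrite -natrX ler_nat ltn_expl.
apply: le_lt_trans n1 _; rewrite -[e]invrK ltf_pV2 ?posrE ?invr_gt0 ?ltr0n//.
apply: lt_le_trans (archi_boundP _) _; first by rewrite invr_ge0 ltW.
by rewrite ler_nat ltnW.
Qed.

Lemma geometric_cvg (V : completeNormedModType C) (u : nat -> V) :
  (forall n, nrm (u n.+1 - u n) <= 2^-1 ^+ n) ->
  exists l, forall e : R, 0 < e -> exists N, forall n, (N <= n)%N ->
    nrm (l - u n) < e.
Proof.
move=> hu.
(* The right-hand side is the exact sum of [2^-1 ^+ j] for j from n to n + k - 1, so the induction
   closes by linear arithmetic. *)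
have ub n k : nrm (u (n + k)%N - u n) <= 2 * 2^-1 ^+ n - 2 * 2^-1 ^+ (n + k).
  elim: k => [|k ih]; first by rewrite addn0 !subrr nrm0.
  rewrite addnS exprS; have := nrm_dist (u (n + k)%N) (u (n + k).+1) (u n).
  by have := hu (n + k)%N; lra.
have ub2 n m : (n <= m)%N -> nrm (u m - u n) <= 2 * 2^-1 ^+ n.
  move=> nm; have := ub n (m - n)%N; rewrite subnKC//.
  have : 0 <= 2^-1 ^+ m :> R by rewrite exprn_ge0// invr_ge0.
  lra.
apply: nrm_complete => e e0.
have [N hN] := exprV2_small (ltac:(lra) : 0 < e / 4).
exists N => m n Nm Nn; have := nrm_dist (u N) (u m) (u n).
have := ub2 _ _ Nm; have := ub2 _ _ Nn; have := hN N (leqnn N).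
by rewrite (nrmBC (u N)); lra.
Qed.

Section Algebra.
Variable A : cstarAlgType R.
Implicit Types x y z w s : A.

Lemma cmul0 x : cmul x 0 = 0.
Proof. by apply: (addrI (cmul x 0)); rewrite -cmulDr !addr0. Qed.

Lemma mul0c x : cmul 0 x = 0.
Proof. by apply: (addrI (cmul 0 x)); rewrite -cmulDl !addr0. Qed.

Lemma cmulN x y : cmul x (- y) = - cmul x y.
Proof. by apply: (addrI (cmul x y)); rewrite -cmulDr !subrr cmul0. Qed.

Lemma mulNc x y : cmul (- x) y = - cmul x y.
Proof. by apply: (addrI (cmul x y)); rewrite -cmulDl !subrr mul0c. Qed.

Lemma cmulB x y z : cmul x (y - z) = cmul x y - cmul x z.
Proof. by rewrite cmulDr cmulN. Qed.

Lemma mulBc x y z : cmul (x - y) z = cmul x z - cmul y z.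
Proof. by rewrite cmulDl mulNc. Qed.

Lemma cstar0 : cstar (0 : A) = 0.
Proof. by apply: (addrI (cstar 0)); rewrite -cstarD !addr0. Qed.

Lemma cstarN x : cstar (- x) = - cstar x.
Proof. by apply: (addrI (cstar x)); rewrite -cstarD !subrr cstar0. Qed.

Lemma cstarB x y : cstar (x - y) = cstar x - cstar y.
Proof. by rewrite cstarD cstarN. Qed.

Lemma nrmM x y : nrm (cmul x y) <= nrm x * nrm y.
Proof. by rewrite -rc_le rcM -!nrmE cnorm_mul_le. Qed.

Lemma nrm_star_mul x : nrm (cmul (cstar x) x) = nrm x ^+ 2.
Proof. by apply: rcI; rewrite rcX2 -!nrmE cnorm_star_mul. Qed.

(** The C*-identity bounds the square of [nrm y] by [nrm (cstar y) * nrm y]; cancel one factor and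
    apply the result to both x and its adjoint. *)
Lemma nrm_star x : nrm (cstar x) = nrm x.
Proof.
have h y : nrm y <= nrm (cstar y).
  have [->|y0] := eqVneq (nrm y) 0; first exact: nrm_ge0.
  have yp : 0 < nrm y by rewrite lt_def y0 nrm_ge0.
  by rewrite -(ler_pM2r yp) -expr2 -nrm_star_mul nrmM.
by apply/eqP; rewrite eq_le h -{2}(cstarK x) h.
Qed.

(** Turns an equation between generators into a computation with inner products: apply it to the
    difference of the two sides. *)
Lemma star_mul_eq0 x : cmul (cstar x) x = 0 -> x = 0.
Proof.
move=> h; apply: nrm_eq0; apply/eqP; rewrite -sqrf_eq0.
by rewrite -nrm_star_mul h nrm0.
Qed.

(* The equation says that [1 + w] is an isometry, in an algebra that need not
   have a unit. *)
Lemma nrm_isometry w : cmul (cstar w) w + w + cstar w = 0 -> nrm w <= 2.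
Proof.
move=> hw.
(* Taking norms here gives [nrm w ^+ 2 <= 2 * nrm w]. *)
have e : cmul (cstar w) w = - (w + cstar w) by apply/eqP; rewrite -addr_eq0 addrA hw.
have := nrm_star_mul w; rewrite e nrmN.
have := nrmD w (cstar w); rewrite nrm_star.
have := nrm_ge0 w; nra.
Qed.

(** * Square root of 1 - x^2 by fixed point iteration *)

Section SquareRoot.
Variable x : A.
Hypothesis (xsa : cstar x = x) (x_small : nrm x <= 2^-1).

(** A fixed point satisfies s^2 + 2s + x^2 = 0, which is (1 + s)^2 = 1 - x^2 with the unit
    eliminated. *)
Let step s := rc (- 2^-1) *: (cmul x x + cmul s s).

Fixpoint sqrt_seq n := if n is k.+1 then step (sqrt_seq k) else 0.

(** The factorization s^2 - t^2 = s(s - t) + (s - t)t holds without commutativity. On the ball of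
    radius 1/4 it makes [step] a contraction with factor 1/4. *)
Lemma step_lip s t : nrm (step s - step t) <= 2^-1 * ((nrm s + nrm t) * nrm (s - t)).
Proof.
rewrite /step -scalerBr nrmZ cabs_rc normrN ger0_norm; last lra.
rewrite [_ + cmul s s]addrC addrKA ler_pM2l; last lra.
have -> : cmul s s - cmul t t = cmul s (s - t) + cmul (s - t) t.
  by rewrite cmulB mulBc addrA subrK.
by apply: le_trans (nrmD _ _) _; have := nrmM s (s - t); have := nrmM (s - t) t; nra.
Qed.

(** The ball of radius 1/4 is stable under [step]: (1/4 + 1/16)/2 = 5/32. *)
Lemma sqrt_seq_small n : nrm (sqrt_seq n) <= 4^-1.
Proof.
elim: n => [|n ih]; first by rewrite /= nrm0; lra.
rewrite /= /step nrmZ cabs_rc normrN ger0_norm; last lra.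
have := nrmD (cmul x x) (cmul (sqrt_seq n) (sqrt_seq n)).
have := nrmM x x; have := nrmM (sqrt_seq n) (sqrt_seq n).
have := nrm_ge0 (sqrt_seq n); have := nrm_ge0 x.
by move: ih x_small; nra.
Qed.

Lemma sqrt_seq_sa n : cstar (sqrt_seq n) = sqrt_seq n.
Proof.
elim: n => [|n ih]; first exact: cstar0.
by rewrite /= /step cstarZ rc_conj cstarD !cstarM xsa ih.
Qed.

Lemma sqrt_seq_comm n : cmul x (sqrt_seq n) = cmul (sqrt_seq n) x.
Proof.
elim: n => [|n ih]; first by rewrite cmul0 mul0c.
rewrite /= /step -cscalerAr -cscalerAl cmulDr cmulDl !cmulA.
by congr (_ *: (_ + _)); rewrite ih -cmulA ih cmulA.
Qed.

(* [1 + s] is the square root of [1 - x^2]. *)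
Lemma sqrt_exists : exists s, [/\ cstar s = s, cmul x s = cmul s x &
  cmul s s + s + s + cmul x x = 0].
Proof.
have [|l hl] := @geometric_cvg A sqrt_seq.
  elim=> [|n ih].
    rewrite expr0 subr0; apply: le_trans (sqrt_seq_small _) _; lra.
  rewrite exprS; have := step_lip (sqrt_seq n.+1) (sqrt_seq n).
  move: ih; have := sqrt_seq_small n; have := sqrt_seq_small n.+1.
  have := nrm_ge0 (sqrt_seq n.+1 - sqrt_seq n).
  rewrite -/(sqrt_seq n.+2) -/(sqrt_seq n.+1); nra.
(* This crude bound keeps the Lipschitz factor of [step] between [sqrt_seq N] and [l] at most (1/4 +
   1)/2 < 1. *)
have l1 : nrm l <= 1.
  have [N hN] := hl (2^-1) ltac:(lra).
  have := nrmD (l - sqrt_seq N) (sqrt_seq N); rewrite subrK.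
  by have := hN N (leqnn N); have := sqrt_seq_small N; lra.
have fix_l : l = step l.
  apply/eqP; rewrite -subr_eq0; apply/eqP/nrm_small => e e0.
  have [N hN] := hl (e / 2) ltac:(lra).
  have := nrm_dist (sqrt_seq N.+1) l (step l).
  have := step_lip (sqrt_seq N) l; have := hN N (leqnn N).
  have := hN N.+1 (leqnSn N); have := sqrt_seq_small N.
  rewrite (nrmBC _ l) -/(sqrt_seq N.+1).
  have := nrm_ge0 (l - sqrt_seq N); nra.
(* Self-adjointness and commutation with x pass from the iterates to the limit; the quadratic
   equation is the fixed point equation, doubled. *)
exists l; split.
- apply/eqP; rewrite -subr_eq0; apply/eqP/nrm_small => e e0.
  have [N hN] := hl (e / 2) ltac:(lra).
  have := nrm_dist (sqrt_seq N) (cstar l) l.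
  rewrite -{1}(sqrt_seq_sa N) -cstarB nrm_star nrmBC.
  by rewrite (nrmBC (sqrt_seq N)); have := hN N (leqnn N); lra.
- apply/eqP; rewrite -subr_eq0; apply/eqP/nrm_small => e e0.
  have [N hN] := hl e ltac:(lra).
  have -> : cmul x l - cmul l x
      = cmul x (l - sqrt_seq N) - cmul (l - sqrt_seq N) x.
    by rewrite cmulB mulBc sqrt_seq_comm opprB addrA subrK.
  have := nrmD (cmul x (l - sqrt_seq N)) (- cmul (l - sqrt_seq N) x).
  rewrite nrmN; have := nrmM x (l - sqrt_seq N); have := nrmM (l - sqrt_seq N) x.
  have := hN N (leqnn N); have := nrm_ge0 (l - sqrt_seq N); move: x_small; nra.
- have h2 : l + l = - (cmul x x + cmul l l).
    rewrite {1 2}fix_l /step -scalerDl -rcD.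
    by rewrite (_ : - 2^-1 + - 2^-1 = -1); [rewrite rcN scaleN1r|lra].
  by rewrite -(addrA (cmul l l)) h2 opprD addrCA subrr addr0 addrC subrr.
Qed.

End SquareRoot.
End Algebra.

Section StarHom.
Variables (A B : cstarAlgType R) (f : A -> B).
Hypothesis hf : star_hom f.

Lemma star_homD x y : f (x + y) = f x + f y.
Proof. by have := star_hom_linear hf 1 x y; rewrite !scale1r. Qed.

Lemma star_hom0 : f 0 = 0.
Proof. by apply: (addrI (f 0)); rewrite -star_homD !addr0. Qed.

Lemma star_homZ a x : f (a *: x) = a *: f x.
Proof. by have := star_hom_linear hf a x 0; rewrite star_hom0 !addr0. Qed.

Lemma star_homN x : f (- x) = - f x.
Proof. by apply: (addrI (f x)); rewrite -star_homD !subrr star_hom0. Qed.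

Lemma star_homB x y : f (x - y) = f x - f y.
Proof. by rewrite star_homD star_homN. Qed.

(** With s from [sqrt_exists], 1 + w = (1 + s) - ix is formally an isometry, a property that f
    preserves in the form of an equation. Since w^* - w = 2ix, the bound 2 on both [f w] and its
    adjoint gives 2 for [f x]. *)
Lemma star_hom_sa_small x : cstar x = x -> nrm x <= 2^-1 -> nrm (f x) <= 2.
Proof.
move=> xsa x_small; have [s [ssa sx s2]] := sqrt_exists xsa x_small.
pose w := s - 'i *: x.
have wst : cstar w = s + 'i *: x.
  by rewrite cstarB cstarZ ssa xsa conjCi scaleNr opprK.
have hw : cmul (cstar w) w + w + cstar w = 0.
  rewrite wst /w cmulDl !cmulB -!cscalerAl -!cscalerAr sx.
  rewrite scalerA -expr2 sqrCi scaleN1r opprK subrKA.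
  by rewrite [s + 'i *: x]addrC -addrA subrKA addrAC -s2 !addrA.
have fw : nrm (f w) <= 2.
  apply: nrm_isometry; rewrite -(star_hom_star hf) -(star_hom_mul hf).
  by rewrite -!star_homD hw star_hom0.
have : nrm (f (cstar w - w)) <= 4.
  rewrite star_homB; apply: le_trans (nrmD _ _) _.
  by rewrite nrmN (star_hom_star hf) nrm_star; lra.
have ii : 'i + 'i = rc 2 * 'i :> C by rewrite -[2]/(1 + 1) rcD rc1 mulrDl mul1r.
rewrite wst /w opprB addrC subrKA -scalerDl star_homZ nrmZ ii.
by rewrite cabsM cabs_i cabs_rc ger0_norm; lra.
Qed.

(** Scaling the previous bound gives the constant 4 on self-adjoint elements. Applied to x^*x, the
    C*-identity on both sides turns 4 into its square root 2. *)
Lemma star_hom_bounded x : nrm (f x) <= 2 * nrm x.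
Proof.
have hsa y : cstar y = y -> nrm (f y) <= 4 * nrm y.
  move=> ysa; have [y0|y0] := eqVneq (nrm y) 0.
    by rewrite (nrm_eq0 y0) star_hom0 !nrm0 mulr0.
  have yp : 0 < nrm y by rewrite lt_def y0 nrm_ge0.
  (* The factor brings the norm of y to exactly 1/2. *)
  have := @star_hom_sa_small (rc (2 * nrm y)^-1 *: y).
  rewrite cstarZ rc_conj ysa star_homZ !nrmZ cabs_rc.
  rewrite ger0_norm ?invr_ge0; last lra.
  rewrite invfM -mulrA mulVf// mulr1 => /(_ erefl (lexx _)).
  rewrite -mulrA mulrCA ler_pdivrMl//; lra.
have := hsa (cmul (cstar x) x).
rewrite cstarM cstarK (star_hom_mul hf) (star_hom_star hf) !nrm_star_mul.
move=> /(_ erefl) h; rewrite -(ler_pXn2r (n := 2)) ?nnegrE ?nrm_ge0//; last first.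
  by rewrite mulr_ge0 ?nrm_ge0.
by rewrite exprMn; apply: le_trans h _; rewrite ler_wpM2r ?exprn_ge0 ?nrm_ge0//; lra.
Qed.

End StarHom.
End CStarFacts.

(** * Closed subalgebras and directed unions *)

Record closed_subalgebra (R : realType) (A : cstarAlgType R) :=
  ClosedSubalgebra {
    csub_set : set A;
    csub_closed : closed csub_set;
    csub_star_subalgebra : star_subalgebra csub_set
  }.

Section ClosedSubalgebra.
Context {R : realType} {A : cstarAlgType R} (S : closed_subalgebra A).
Local Notation C := (Cplx R).

(** Membership is made boolean so that elements of the subtype are equal as soon as their values
    are, and so that the module structure is inherited. *)
Definition csub_pred : {pred A} := fun x => `[< csub_set S x >].

Definition csub := {x : A | csub_pred x}.

HB.instance Definition _ := Choice.on csub.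
HB.instance Definition _ := [isSub of csub for @sval A csub_pred].

Lemma csub_submod_closed : GRing.submod_closed csub_pred.
Proof.
split=> [|a x y /asboolP Sx /asboolP Sy]; apply/asboolP.
  exact: star_subalgebra0 (csub_star_subalgebra S).
exact: star_subalgebra_linear (csub_star_subalgebra S) _ _ _ Sx Sy.
Qed.

HB.instance Definition _ :=
  GRing.isSubmodClosed.Build C A csub_pred csub_submod_closed.
HB.instance Definition _ := [SubChoice_isSubLmodule of csub by <:].

Lemma csub_normD (x y : csub) : `|val (x + y)| <= `|val x| + `|val y|.
Proof. exact: ler_normD. Qed.

Lemma csub_normZ (a : C) (x : csub) : `|val (a *: x)| = `|a| * `|val x|.
Proof. exact: normrZ. Qed.

Lemma csub_norm0_eq0 (x : csub) : `|val x| = 0 -> x = 0.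
Proof. by move=> /normr0_eq0 x0; apply/val_inj. Qed.

HB.instance Definition _ :=
  Lmodule_isNormed.Build C csub csub_normD csub_normZ csub_norm0_eq0.

Lemma csubP (x : csub) : csub_set S (val x).
Proof. by have /asboolP := valP x. Qed.

(** A Cauchy filter is pushed forward to A, where it converges; the limit lies in the subalgebra by
    closedness, and convergence pulls back because the norm is the one of A. *)
Lemma csub_complete (F : set_system csub) : ProperFilter F -> cauchy F -> cvg F.
Proof.
move=> FF /cauchyP hF.
have : cauchy (val @ F).
  apply: cauchy_exP => e e0; have [x Fx] := hF e e0; exists (val x).
  change (F [set y : csub | ball (val x) e (val y)]).
  apply: filterS Fx => y; rewrite -!ball_normE /ball_ /=.
  by move=> xy; suff : `|val (x - y)| < e by [].
move=> /cauchy_cvg /cvg_ex [l Fl].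
have Sl : csub_pred l.
  apply/asboolP/(@csub_closed _ _ S) => B /Fl FB.
  change (F [set y : csub | B (val y)]) in FB.
  by have [y By] := filter_ex FB; exists (val y); split; [exact: csubP|].
apply/cvg_ex; exists (exist _ l Sl : csub) => B /nbhs_ballP [e /= e0 eB].
have /Fl : nbhs l (ball l e) by exact: nbhsx_ballx.
move=> Fle; change (F [set y : csub | ball l e (val y)]) in Fle.
apply: filterS Fle => y ly; apply: eB; move: ly.
rewrite -!ball_normE /ball_ /= => ly.
by suff : `|val ((exist _ l Sl : csub) - y)| < e by [].
Qed.

HB.instance Definition _ := Uniform_isComplete.Build csub csub_complete.

Lemma csub_mul_subproof (x y : csub) : csub_pred (cmul (val x) (val y)).
Proof.
by apply/asboolP/(star_subalgebra_mul (csub_star_subalgebra S)); exact: csubP.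
Qed.

Lemma csub_star_subproof (x : csub) : csub_pred (cstar (val x)).
Proof.
by apply/asboolP/(star_subalgebra_star (csub_star_subalgebra S)); exact: csubP.
Qed.

Let csub_mul (x y : csub) : csub := exist csub_pred _ (csub_mul_subproof x y).
Let csub_star (x : csub) : csub := exist csub_pred _ (csub_star_subproof x).

Let csub_mulA : forall x y z, csub_mul x (csub_mul y z) = csub_mul (csub_mul x y) z.
Proof. by move=> *; apply: val_inj; exact: cmulA. Qed.

Let csub_mulDl : forall x y z, csub_mul (x + y) z = csub_mul x z + csub_mul y z.
Proof. by move=> *; apply: val_inj; exact: cmulDl. Qed.

Let csub_mulDr : forall x y z, csub_mul x (y + z) = csub_mul x y + csub_mul x z.
Proof. by move=> *; apply: val_inj; exact: cmulDr. Qed.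

Let csub_scaleAl : forall (a : C) x y, a *: csub_mul x y = csub_mul (a *: x) y.
Proof. by move=> *; apply: val_inj; exact: cscalerAl. Qed.

Let csub_scaleAr : forall (a : C) x y, a *: csub_mul x y = csub_mul x (a *: y).
Proof. by move=> *; apply: val_inj; exact: cscalerAr. Qed.

Let csub_starK : forall x, csub_star (csub_star x) = x.
Proof. by move=> *; apply: val_inj; exact: cstarK. Qed.

Let csub_starD : forall x y, csub_star (x + y) = csub_star x + csub_star y.
Proof. by move=> *; apply: val_inj; exact: cstarD. Qed.

Let csub_starZ : forall (a : C) x, csub_star (a *: x) = a^* *: csub_star x.
Proof. by move=> *; apply: val_inj; exact: cstarZ. Qed.

Let csub_starM : forall x y,
  csub_star (csub_mul x y) = csub_mul (csub_star y) (csub_star x).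
Proof. by move=> *; apply: val_inj; exact: cstarM. Qed.

Let csub_norm_mul_le (x y : csub) : `|csub_mul x y| <= `|x| * `|y|.
Proof. exact: cnorm_mul_le. Qed.

Let csub_norm_star_mul (x : csub) : `|csub_mul (csub_star x) x| = `|x| ^+ 2.
Proof. exact: cnorm_star_mul. Qed.

HB.instance Definition _ := CompleteNormedModule_isCStarAlgebra.Build R csub
  csub_mulA csub_mulDl csub_mulDr csub_scaleAl csub_scaleAr csub_starK csub_starD
  csub_starZ csub_starM csub_norm_mul_le csub_norm_star_mul.

Lemma csub_val_hom : star_hom (val : csub -> A).
Proof. by []. Qed.

Lemma nrm_csub (x : csub) : nrm x = nrm (val x).
Proof. by []. Qed.

End ClosedSubalgebra.

Arguments csub {R A} S.

(** * Dense directed unions as inductive limits *)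

Section DirectedUnion.
Context {R : realType}.
Local Notation C := (Cplx R).

(** Suited to density arguments: errors appear as a constant times d, and [d <= 1] lets norms of
    approximants be bounded independently of d. If [K] is at least [e], take d = e / K, otherwise d
    = 1. *)
Lemma nrm_small_scale (V : normedModType C) (x : V) (K : R) :
  (forall d : R, 0 < d -> d <= 1 -> nrm x <= K * d) -> x = 0.
Proof.
move=> h; apply: nrm_small => e e0.
have [K0|K0] := lerP K 0.
  by have := h 1 ltac:(lra) ltac:(lra); lra.
have [eK|eK] := lerP e K.
  have := h (e / K); rewrite divr_gt0// ler_pdivrMr// mul1r => /(_ isT eK).
  by rewrite mulrCA divff ?mulr1// gt_eqF.
by have := h 1 ltac:(lra) ltac:(lra); lra.
Qed.

Lemma nrm_mul_dist (A : cstarAlgType R) (x y a b : A) :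
  nrm (cmul x y - cmul a b) <= nrm x * nrm (y - b) + nrm (x - a) * nrm b.
Proof.
have -> : cmul x y - cmul a b = cmul x (y - b) + cmul (x - a) b.
  by rewrite cmulB mulBc addrA subrK.
by apply: le_trans (nrmD _ _) _; apply: lerD; apply: nrmM.
Qed.

Variables (A : cstarAlgType R) (I : Type) (le : I -> I -> Prop).
Hypotheses (I_inhabited : inhabited I) (le_refl : forall i, le i i).
Hypothesis le_trans : forall i j k, le i j -> le j k -> le i k.
Hypothesis le_directed : forall i j, exists k, le i k /\ le j k.
Variable S : I -> closed_subalgebra A.
Hypothesis S_mono : forall i j, le i j -> csub_set (S i) `<=` csub_set (S j).

(** The inclusion when [le i j]; the default 0 only makes the map total for other pairs of
    indices. *)
Definition union_map i j (x : csub (S i)) : csub (S j) := insubd 0 (val x).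

Lemma val_union_map i j (x : csub (S i)) : le i j -> val (union_map j x) = val x.
Proof.
by move=> ij; apply: insubdK; apply/asboolP/(S_mono ij)/csubP.
Qed.

Lemma union_map_hom i j : le i j -> star_hom (@union_map i j).
Proof.
move=> ij; split=> *; apply: val_inj.
- by rewrite /= !val_union_map.
- by rewrite /= !val_union_map.
- by rewrite /= !val_union_map.
Qed.

Lemma union_map_id i x : @union_map i i x = x.
Proof. by apply: val_inj; rewrite val_union_map. Qed.

Lemma union_map_comp i j k : le i j -> le j k ->
  forall x, @union_map j k (@union_map i j x) = @union_map i k x.
Proof.
move=> ij jk x; apply: val_inj; rewrite !val_union_map//.
exact: le_trans ij jk.
Qed.

Definition union_system : directed_system R :=
  @DirectedSystem R I le I_inhabited le_refl le_trans le_directed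
    (fun i => csub (S i)) union_map union_map_hom union_map_id union_map_comp.

Hypothesis S_dense : forall (x : A) (e : R), 0 < e ->
  exists i (a : csub (S i)), nrm (x - val a) < e.

Section Extension.
Variables (B : cstarAlgType R) (chi : forall i, csub (S i) -> B).
Hypothesis chi_hom : forall i, star_hom (@chi i).
Hypothesis chi_map : forall i j, le i j -> forall x, chi (union_map j x) = @chi i x.

(** Both elements are moved to a common index k, where [chi k] is bounded. This makes the
    prospective extension well defined and continuous. *)
Lemma chi_lip i j (x : csub (S i)) (y : csub (S j)) :
  nrm (chi x - chi y) <= 2 * nrm (val x - val y).
Proof.
have [k [ik jk]] := le_directed i j.
rewrite -(chi_map ik) -(chi_map jk) -(star_homB (chi_hom k)).
rewrite -(val_union_map x ik) -(val_union_map y jk).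
exact: (star_hom_bounded (chi_hom k) (union_map k x - union_map k y)).
Qed.

Lemma dense2 (x y : A) (e : R) : 0 < e -> exists i (a b : csub (S i)),
  nrm (x - val a) < e /\ nrm (y - val b) < e.
Proof.
move=> e0; have [i [a xa]] := S_dense x e0; have [j [b yb]] := S_dense y e0.
have [k [ik jk]] := le_directed i j.
by exists k, (union_map k a), (union_map k b); rewrite !val_union_map.
Qed.

(** y is the limit of [chi] along a sequence of approximants of x. Stating the estimate for every
    [a] at every index records independence of that sequence, and yields both the extension property
    and the algebraic identities. *)
Lemma extension_exists x : exists y : B, forall i (a : csub (S i)),
  nrm (y - chi a) <= 2 * nrm (x - val a).
Proof.
have ex_u n : exists p : {i & csub (S i)}, nrm (x - val (projT2 p)) < 2^-1 ^+ n.
  have [|i [a xa]] := @S_dense x (2^-1 ^+ n); first by rewrite exprn_gt0// invr_gt0.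
  by exists (existT _ i a).
have [u hu] := choice ex_u.
have [|y hy] := @nrm_complete _ B (fun n => chi (projT2 (u n))).
  move=> e e0; have [N hN] := exprV2_small (ltac:(lra) : 0 < e / 4).
  exists N => m n Nm Nn.
  have := chi_lip (projT2 (u m)) (projT2 (u n)).
  have := nrm_dist x (val (projT2 (u m))) (val (projT2 (u n))).
  rewrite (nrmBC _ x); have := hu m; have := hu n; have := hN _ Nm; have := hN _ Nn.
  lra.
exists y => i a; apply/ler_addgt0Pr => e e0.
have [N hN] := hy (e / 2) ltac:(lra).
have [M hM] := exprV2_small (ltac:(lra) : 0 < e / 4).
pose n := maxn M N; have := hN n (leq_maxr _ _); have := hM n (leq_maxl _ _).
have := hu n; have := nrm_dist (chi (projT2 (u n))) y (chi a).
have := chi_lip (projT2 (u n)) a.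
have := nrm_dist x (val (projT2 (u n))) (val a); rewrite (nrmBC _ x).
lra.
Qed.

Lemma extension : exists h : A -> B,
  star_hom h /\ forall i (a : csub (S i)), h (val a) = chi a.
Proof.
have [h hP] := choice extension_exists.
have [i0] := I_inhabited.
have h_bound x : nrm (h x) <= 2 * nrm x.
  by have := hP x i0 0; rewrite (star_hom0 (chi_hom i0)) !subr0.
exists h; split; last first.
  move=> i a; apply/eqP; rewrite -subr_eq0; apply/eqP/nrm_eq0/le_anti.
  by have := hP (val a) i a; rewrite subrr nrm0 mulr0 nrm_ge0 => ->.
split=> [c x y|x y|x]; apply/eqP; rewrite -subr_eq0; apply/eqP.
(* The extension estimate for c x + y costs 2(|c| + 1)d, and replacing [chi a], [chi b] by [h x],
   [h y] costs as much again. *)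
- apply: (@nrm_small_scale _ _ (4 * (cabs c + 1))) => d d0 _.
  have [i [a [b [xa yb]]]] := dense2 x y d0.
  have := hP (c *: x + y) i (c *: a + b).
  rewrite (star_hom_linear (chi_hom i)) /=.
  have := nrm_dist (c *: chi a + chi b) (h (c *: x + y)) (c *: h x + h y).
  have -> : c *: x + y - (c *: val a + val b) = c *: (x - val a) + (y - val b).
    by rewrite scalerBr opprD addrACA.
  have -> : c *: chi a + chi b - (c *: h x + h y)
      = c *: (chi a - h x) + (chi b - h y).
    by rewrite scalerBr opprD addrACA.
  have := nrmD (c *: (x - val a)) (y - val b).
  have := nrmD (c *: (chi a - h x)) (chi b - h y).
  rewrite !nrmZ (nrmBC _ (h x)) (nrmBC _ (h y)).
  have := hP x i a; have := hP y i b; have := cabs_ge0 c; nra.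
(* The four product errors add up to at most 6(|x| + |y| + 1)d; [d <= 1] is what bounds the norm of
   [a] by |x| + 1 and that of [b] by |y| + 1. *)
- apply: (@nrm_small_scale _ _ (8 * (nrm x + nrm y + 1))) => d d0 d1.
  have [i [a [b [xa yb]]]] := dense2 x y d0.
  have := hP (cmul x y) i (cmul a b).
  rewrite (star_hom_mul (chi_hom i)) /=.
  have := nrm_dist (cmul (chi a) (chi b)) (h (cmul x y)) (cmul (h x) (h y)).
  have := nrm_mul_dist x y (val a) (val b).
  have := nrm_mul_dist (chi a) (chi b) (h x) (h y).
  have a_le : nrm (val a) <= nrm x + 1.
    by have := nrmD x (val a - x); rewrite addrC subrK (nrmBC _ x); lra.
  have b_le : nrm (val b) <= nrm y + 1.
    by have := nrmD y (val b - y); rewrite addrC subrK (nrmBC _ y); lra.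
  have chia_le : nrm (chi a) <= 2 * (nrm x + 1).
    by have := star_hom_bounded (chi_hom i) a; rewrite nrm_csub; lra.
  have hxa : nrm (chi a - h x) <= 2 * d by rewrite nrmBC; have := hP x i a; lra.
  have hyb : nrm (chi b - h y) <= 2 * d by rewrite nrmBC; have := hP y i b; lra.
  have := ler_pM (nrm_ge0 _) (nrm_ge0 _) chia_le hyb.
  have := ler_pM (nrm_ge0 _) (nrm_ge0 _) hxa (h_bound y).
  have := ler_pM (nrm_ge0 _) (nrm_ge0 _) (lexx (nrm x)) (ltW yb).
  have := ler_pM (nrm_ge0 _) (nrm_ge0 _) (ltW xa) b_le.
  have := mulr_ge0 (nrm_ge0 x) (ltW d0); have := mulr_ge0 (nrm_ge0 y) (ltW d0).
  lra.
- apply: (@nrm_small_scale _ _ 4) => d d0 d1.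
  have [i [a xa]] := S_dense x d0.
  have := hP (cstar x) i (cstar a).
  rewrite (star_hom_star (chi_hom i)) /=.
  have := nrm_dist (cstar (chi a)) (h (cstar x)) (cstar (h x)).
  rewrite -!cstarB !nrm_star (nrmBC _ (h x)); have := hP x i a; lra.
Qed.

End Extension.

(** Existence is [extension]. For uniqueness, two bounded maps that agree on a dense union coincide;
    the constant 4 is 2 + 2 from [star_hom_bounded]. *)
Lemma union_inductive_limit : inductive_limit union_system A.
Proof.
exists (fun i (x : csub (S i)) => val x); split.
  split=> [i|i j ij x]; first exact: csub_val_hom.
  exact: val_union_map.
move=> B chi [chi_hom chi_map].
have [h [h_hom hchi]] := extension chi_hom chi_map.
exists h; split => // h' [h'_hom h'chi]; apply/funext => x.
apply/eqP; rewrite -subr_eq0; apply/eqP/(@nrm_small_scale _ _ 4) => d d0 _.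
have [i [a xa]] := S_dense x d0.
have := nrm_dist (chi i a) (h x) (h' x).
rewrite -{1}hchi -h'chi -(star_homB h_hom) -(star_homB h'_hom).
have := star_hom_bounded h_hom (x - val a).
have := star_hom_bounded h'_hom (val a - x).
rewrite (nrmBC _ x); lra.
Qed.

End DirectedUnion.

(** * Finite dimensional subalgebras *)

Section FiniteSpan.
Context {R : realType}.
Local Notation C := (Cplx R).

Lemma real_complete (u : nat -> R) :
  (forall e : R, 0 < e -> exists N, forall m n, (N <= m)%N -> (N <= n)%N ->
     `|u m - u n| < e) ->
  exists l, forall e : R, 0 < e -> exists N, forall n, (N <= n)%N ->
     `|l - u n| < e.
Proof.
move=> h.
have : cauchy (u @ \oo).
  apply: cauchy_exP => e e0; have [N hN] := h e e0.
  exists (u N); exists N => // n /= Nn; rewrite -ball_normE /ball_ /=.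
  exact: hN.
move=> /cauchy_cvg /cvg_ex [l ul]; exists l => e e0.
have /ul [N _ hN] : nbhs l (ball l e) by apply: nbhsx_ballx.
by exists N => n /hN /=; rewrite -ball_normE.
Qed.

Lemma sqrt_addsq (a b : R) : [/\ `|a| <= Num.sqrt (a ^+ 2 + b ^+ 2),
  `|b| <= Num.sqrt (a ^+ 2 + b ^+ 2) & Num.sqrt (a ^+ 2 + b ^+ 2) <= `|a| + `|b|].
Proof.
have h0 := sqr_ge0 a; have h1 := sqr_ge0 b.
split.
- by rewrite -sqrtr_sqr ler_sqrt ?addr_ge0// lerDl.
- by rewrite -sqrtr_sqr ler_sqrt ?addr_ge0// lerDr.
- rewrite -[leRHS]ger0_norm ?addr_ge0// -sqrtr_sqr ler_sqrt ?sqr_ge0//.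
  rewrite sqrrD !real_normK ?num_real// lerD2r lerDl.
  by rewrite mulrn_wge0// mulr_ge0.
Qed.

Lemma cabs_ReIm (z : C) : [/\ `|complex.Re z| <= cabs z, `|complex.Im z| <= cabs z &
  cabs z <= `|complex.Re z| + `|complex.Im z|].
Proof.
have -> : cabs z = Num.sqrt (complex.Re z ^+ 2 + complex.Im z ^+ 2).
  by rewrite /cabs normc_def.
exact: sqrt_addsq.
Qed.

Lemma cplx_complete (u : nat -> C) :
  (forall e : R, 0 < e -> exists N, forall m n, (N <= m)%N -> (N <= n)%N ->
     cabs (u m - u n) < e) ->
  exists l, forall e : R, 0 < e -> exists N, forall n, (N <= n)%N ->
     cabs (l - u n) < e.
Proof.
move=> h.
have ReB (a b : C) : complex.Re (a - b) = complex.Re a - complex.Re b.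
  by case: a b => [? ?] [? ?].
have ImB (a b : C) : complex.Im (a - b) = complex.Im a - complex.Im b.
  by case: a b => [? ?] [? ?].
have [|x hx] := @real_complete (fun n => complex.Re (u n)).
  move=> e /h [N hN]; exists N => m n Nm Nn; rewrite -ReB.
  by have [k _ _] := cabs_ReIm (u m - u n); apply: le_lt_trans k (hN _ _ Nm Nn).
have [|y hy] := @real_complete (fun n => complex.Im (u n)).
  move=> e /h [N hN]; exists N => m n Nm Nn; rewrite -ImB.
  by have [_ k _] := cabs_ReIm (u m - u n); apply: le_lt_trans k (hN _ _ Nm Nn).
exists (Complex x y : C) => e e0.
have [M hM] := hx (e / 2) ltac:(lra); have [N hN] := hy (e / 2) ltac:(lra).
exists (maxn M N) => n; rewrite geq_max => /andP[/hM k1 /hN k2].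
have [_ _] := cabs_ReIm ((Complex x y : C) - u n); rewrite ReB ImB /=; lra.
Qed.

Lemma subrBB_sub (V : zmodType) (x a b s t : V) :
  a - b - (s - t) = (x - b - s) - (x - a - t).
Proof.
rewrite (opprD (x - a)) addrACA -opprD; congr (_ - _).
by rewrite opprB [RHS]addrC addrA subrK.
Qed.

Lemma subr_sub_sub (V : zmodType) (x a b s : V) :
  x - a - s = (x - b - s) - (a - b).
Proof. by rewrite opprB [RHS]addrAC addrA subrK. Qed.

Section Span.
Variable A : cstarAlgType R.
Implicit Types (x y : A) (D : seq A).

Lemma cstar_closedP (S : set A) :
  closed S <->
  forall x, (forall e : R, 0 < e -> exists2 y, S y & nrm (x - y) < e) -> S x.
Proof. exact: closedP_nrm. Qed.

(** The linear span, peeled off one generator at a time to match the induction in [span_closed]. *)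
Fixpoint span D : set A :=
  if D is b :: D' then [set x | exists c : C, span D' (x - c *: b)]
  else [set 0].

Lemma span0 D : span D 0.
Proof. by elim: D => //= b D ih; exists 0; rewrite scale0r subr0. Qed.

Lemma span_linear D (a : C) x y : span D x -> span D y -> span D (a *: x + y).
Proof.
elim: D x y => [x y -> ->|b D ih x y [c hc] [c' hc']] /=.
  by rewrite scaler0 addr0.
exists (a * c + c'); have := ih _ _ hc hc'.
by rewrite scalerBr scalerA addrACA -opprD -scalerDl.
Qed.

Lemma span_mem D x : x \in D -> span D x.
Proof.
elim: D => //= b D ih; rewrite inE => /predU1P [->|/ih xD].
  by exists 1; rewrite scale1r subrr; exact: span0.
by exists 0; rewrite scale0r subr0.
Qed.

(** Used as the induction principle for membership in a span. *)
Lemma span_min D (V : set A) : V 0 ->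
  (forall (a : C) x y, V x -> V y -> V (a *: x + y)) ->
  (forall x, x \in D -> V x) -> span D `<=` V.
Proof.
move=> V0 Vlin; elim: D => [|b D ih] DV x /=; first by move=> ->.
move=> [c /(ih _)] h; rewrite -(subrK (c *: b) x) addrC; apply: Vlin.
  by apply: DV; rewrite inE eqxx.
by apply: h => y yD; apply: DV; rewrite inE yD orbT.
Qed.

Lemma span_sub D D' : {subset D <= D'} -> span D `<=` span D'.
Proof.
move=> DD'; apply: span_min => [|a x y|x /DD']; first exact: span0.
  exact: span_linear.
exact: span_mem.
Qed.

Lemma spanZ D (a : C) x : span D x -> span D (a *: x).
Proof. by move=> Dx; rewrite -[_ *: _]addr0; apply: span_linear => //; exact: span0. Qed.

Lemma spanN D x : span D x -> span D (- x).
Proof. by rewrite -scaleN1r; apply: spanZ. Qed.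

Lemma spanB D x y : span D x -> span D y -> span D (x - y).
Proof.
by move=> Dx Dy; rewrite -[x]scale1r; apply: span_linear => //; apply: spanN.
Qed.

Lemma span_star_subalgebra D :
  (forall x y, x \in D -> y \in D -> span D (cmul x y)) ->
  (forall x, x \in D -> span D (cstar x)) -> star_subalgebra (span D).
Proof.
move=> hm hs; split=> [|a x y|x y Dx Dy|x Dx]; first exact: span0.
- exact: span_linear.
- suff : span D `<=` [set x | span D (cmul x y)] by apply.
  apply: span_min => [|a x1 x2 /= h1 h2|z zD] /=.
  + by rewrite mul0c; exact: span0.
  + by rewrite cmulDl -cscalerAl; exact: span_linear.
  suff : span D `<=` [set y | span D (cmul z y)] by apply.
  apply: span_min => [|a x1 x2 /= h1 h2|t tD] /=.
  + by rewrite cmul0; exact: span0.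
  + by rewrite cmulDr -cscalerAr; exact: span_linear.
  exact: hm.
- suff : span D `<=` [set x | span D (cstar x)] by apply.
  apply: span_min => [|a x1 x2 /= h1 h2|z zD] /=.
  + by rewrite cstar0; exact: span0.
  + by rewrite cstarD cstarZ; exact: span_linear.
  exact: hs.
Qed.

Lemma span_coord D x : span D x ->
  exists c : nat -> C, x = \sum_(i < size D) c i *: nth 0 D i.
Proof.
elim: D x => [|b D ih] x /=; first by move=> ->; exists (fun=> 0); rewrite big_ord0.
move=> [c /ih [f hf]]; exists (fun n => if n is k.+1 then f k else c).
by rewrite big_ord_recl /= -hf addrC subrK.
Qed.

(** Induction on the generators. If b lies in the span of the rest, nothing changes. Otherwise b has
    positive distance d from that closed span, so the coefficients of b in approximants of x form a
    Cauchy sequence, whose limit is the coefficient of x. *)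
Lemma span_closed D : closed (span D).
Proof.
elim: D => [|b D ih].
  apply/cstar_closedP => x hx; apply: nrm_small => e /hx [y /= ->].
  by rewrite subr0 => /ltW.
have [bD|bD] := pselect (span D b).
  suff -> : span (b :: D) = span D by [].
  apply/seteqP; split=> x; last first.
    by apply: span_sub => y yD; rewrite inE yD orbT.
  move=> [c h]; rewrite -(subrK (c *: b) x) addrC.
  exact: span_linear.
have [d d0 hd] : exists2 d : R, 0 < d & forall s, span D s -> d <= nrm (b - s).
  apply: contrapT => h; apply: bD; move/cstar_closedP : ih; apply => e e0.
  apply: contrapT => k; apply: h; exists e => // s Ds.
  by rewrite leNgt; apply/negP => bs; apply: k; exists s.
(* By homogeneity the distance from t b to the span is at least |t| d; this controls coefficients by
   norms. *)
have hdZ (t : C) s : span D s -> cabs t * d <= nrm (t *: b - s).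
  move=> Ds; have [->|t0] := eqVneq t 0; first by rewrite cabs0 mul0r nrm_ge0.
  have -> : t *: b - s = t *: (b - t^-1 *: s).
    by rewrite scalerBr scalerA divff// scale1r.
  by rewrite nrmZ ler_wpM2l ?cabs_ge0// hd//; exact: spanZ.
apply/cstar_closedP => x hx.
have ex_cs n : exists p : C * A, span D p.2 /\ nrm (x - p.1 *: b - p.2) < 2^-1 ^+ n.
  have [|y [c Dy] xy] := hx (2^-1 ^+ n); first by rewrite exprn_gt0// invr_gt0.
  by exists (c, y - c *: b); split=> //=; rewrite opprB addrA subrK.
have [p hp] := choice ex_cs.
have cd m n : cabs ((p m).1 - (p n).1) * d <= 2^-1 ^+ m + 2^-1 ^+ n.
  have [Dm xm] := hp m; have [Dn xn] := hp n.
  apply: le_trans (hdZ _ _ (spanB Dn Dm)) _.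
  rewrite (_ : _ - _ = (x - (p n).1 *: b - (p n).2) - (x - (p m).1 *: b - (p m).2)).
    by apply: le_trans (nrmD _ _) _; rewrite nrmN; lra.
  by rewrite scalerBl; exact: subrBB_sub.
have [|c hc] := @cplx_complete (fun n => (p n).1).
  move=> e e0; have ed := mulr_gt0 e0 d0.
  have [N hN] := exprV2_small (ltac:(lra) : 0 < e * d / 2).
  exists N => m n Nm Nn; rewrite -(ltr_pM2r d0).
  by have := cd m n; have := hN m Nm; have := hN n Nn; lra.
exists c; move/cstar_closedP : ih; apply => e e0.
(* Adding 1 gives a positive divisor without knowing that b is nonzero. *)
have bp : 0 < nrm b + 1 by have := nrm_ge0 b; lra.
have e2 : 0 < e / 2 by rewrite divr_gt0.
have [M hM] := hc _ (divr_gt0 e2 bp).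
have [N hN] := exprV2_small e2.
have [n Mn Nn] : exists2 n, (M <= n)%N & (N <= n)%N.
  by exists (maxn M N); rewrite ?leq_maxl ?leq_maxr.
have [Dn xn] := hp n; exists (p n).2 => //.
have := hM n Mn; have := hN n Nn; rewrite (ltr_pdivlMr _ _ bp) mulrDr mulr1.
have -> : x - c *: b - (p n).2 = (x - (p n).1 *: b - (p n).2) - (c - (p n).1) *: b.
  by rewrite scalerBl; exact: subr_sub_sub.
have := nrmD (x - (p n).1 *: b - (p n).2) (- ((c - (p n).1) *: b)).
rewrite nrmN nrmZ; have := cabs_ge0 (c - (p n).1); have := nrm_ge0 b; lra.
Qed.

End Span.

Lemma csub_span_finite_dimensional (A : cstarAlgType R) (S : closed_subalgebra A)
  (D : seq A) : csub_set S = span D -> finite_dimensional (csub S).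
Proof.
move=> SD; exists (size D), (fun i => insubd 0 (nth 0 D i)) => x.
have : span D (val x) by rewrite -SD; exact: csubP.
move=> /span_coord [c xc]; exists (fun i => c i); apply: val_inj.
rewrite xc raddf_sum; apply: eq_bigr => i _; rewrite /= insubdK//.
by apply/asboolP; rewrite SD; apply/span_mem/mem_nth.
Qed.

End FiniteSpan.

(** * Functions vanishing at infinity on a discrete space *)

(** If A were infinite, the sets containing all but finitely many points of A would form a proper
    filter. A cluster point x is impossible, as A without x belongs to the filter and misses the
    neighborhood {x}. *)
Lemma discrete_compact_finite (T : discreteTopologicalType) (A : set T) :
  compact A -> finite_set A.
Proof.
move=> cA; apply: contrapT => infA.
pose F : set_system T := [set B | finite_set (A `\` B)].
have FF : ProperFilter F.
  apply: Build_ProperFilter_ex => [B FB|].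
    apply: contrapT => nB; apply: infA; apply: sub_finite_set FB => x Ax.
    by split=> // Bx; apply: nB; exists x.
  split=> [|B D FB FD|B D BD].
  - by rewrite /F /= setDT; exact: finite_set0.
  - by rewrite /F /= setDIr finite_setU.
  - by apply: sub_finite_set => x [Ax nDx]; split=> // /BD.
have [|x [Ax /(_ (A `\` [set x]) [set x]) h]] := cA F FF.
  by rewrite /F /= setDv; exact: finite_set0.
have [||y [[_ nyx] yx]] := h; [|exact: discrete_set1|by []].
by apply: sub_finite_set (finite_set1 x) => y [Ay /not_andP [//|/contrapT]].
Qed.

Section DiscreteC0.
Context {R : realType}.
Local Notation C := (Cplx R).
Variable T : discreteTopologicalType.
Implicit Types f g : T -> C.

Lemma discrete_C0P f :
  C0 f <-> forall e : R, 0 < e -> finite_set [set v | e <= cabs (f v)].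
Proof.
split=> [[_ h] e /h|h]; first exact: discrete_compact_finite.
split; first exact: discrete_continuous.
by move=> e /h; exact: finite_compact.
Qed.

Lemma C0_le f g (K : R) : C0 f -> (forall v, cabs (g v) <= K * cabs (f v)) -> C0 g.
Proof.
move=> /discrete_C0P hf gf; apply/discrete_C0P => e e0.
(* K may be zero or negative, so this larger positive constant serves as divisor. *)
have K0 : 0 < `|K| + 1 by rewrite ltr_wpDl.
apply: sub_finite_set (hf _ (divr_gt0 e0 K0)) => v /= ev.
rewrite ler_pdivrMr// mulrC; apply: le_trans ev (le_trans (gf v) _).
by rewrite ler_wpM2r ?cabs_ge0// ler_wpDr// ler_norm.
Qed.

Lemma cabsD (a b : C) : cabs (a + b) <= cabs a + cabs b.
Proof. by rewrite -rc_le rcD -!cabsE ler_normD. Qed.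

Lemma cabs_conj (a : C) : cabs a^* = cabs a.
Proof. by apply: rcI; rewrite -!cabsE norm_conjC. Qed.

Lemma C0D f g : C0 f -> C0 g -> C0 (f + g).
Proof.
move=> /discrete_C0P hf /discrete_C0P hg; apply/discrete_C0P => e e0.
have e2 : 0 < e / 2 by rewrite divr_gt0.
have : finite_set ([set v | e / 2 <= cabs (f v)] `|` [set v | e / 2 <= cabs (g v)]).
  by rewrite finite_setU; split; [exact: hf|exact: hg].
apply: sub_finite_set => v /= ev; apply/orP; rewrite -implyNb -ltNge.
by apply/implyP => fv; have := cabsD (f v) (g v); lra.
Qed.

Lemma C0Z (a : C) f : C0 f -> C0 (a *: f).
Proof. by move=> hf; apply: (C0_le (K := cabs a) hf) => v; rewrite -cabsM. Qed.

Lemma C0_conj f : C0 f -> C0 (fun v => (f v)^*).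
Proof.
by move=> hf; apply: (C0_le (K := 1) hf) => v; rewrite cabs_conj mul1r.
Qed.

Lemma C0_finite_support f (F : {fset T}) :
  (forall v, f v != 0 -> v \in F) -> C0 f.
Proof.
move=> fF; apply/discrete_C0P => e e0.
apply: sub_finite_set (finite_fset F) => v /= ev; apply: fF.
by apply: contraTneq ev => ->; rewrite cabs0 -ltNge.
Qed.

Lemma C0_0 : C0 (0 : T -> C).
Proof. by apply: (@C0_finite_support _ fset0) => v; rewrite eqxx. Qed.

End DiscreteC0.

(** * Boundedness of star homomorphisms on [C0] *)

Section DiscreteGraphAlgebra.
Context {R : realType}.
Local Notation C := (Cplx R).
Variables (V W : choiceType) (d r : W -> V).
Local Notation E := (discrete_graph d r).
Variables (A : cstarAlgType R) (T0 : (vertex E -> C) -> A).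
Hypothesis hT0 : C0_star_hom T0.

Lemma C0_hom0 : T0 0 = 0.
Proof.
have := C0_star_hom_linear hT0 1 (C0_0 _) (C0_0 _).
by rewrite scaler0 addr0 scale1r => h; apply: (addrI (T0 0)); rewrite addr0 -h.
Qed.

Lemma C0_homD f g : C0 f -> C0 g -> T0 (f + g) = T0 f + T0 g.
Proof.
by move=> hf hg; have := C0_star_hom_linear hT0 1 hf hg; rewrite !scale1r.
Qed.

Lemma C0_homZ (a : C) f : C0 f -> T0 (a *: f) = a *: T0 f.
Proof.
move=> hf; have := C0_star_hom_linear hT0 a hf (C0_0 _).
by rewrite C0_hom0 !addr0.
Qed.

(** The isometry argument of [star_hom_sa_small], carried out among functions: the square root is
    now pointwise, s = sqrt(1 - g^2) - 1, and w = s - ig. *)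
Lemma C0_hom_real_bounded (g : vertex E -> R) : C0 (fun v => rc (g v)) ->
  (forall v, `|g v| <= 1) -> nrm (T0 (fun v => rc (g v))) <= 2.
Proof.
move=> hg g1.
pose s v := Num.sqrt (1 - g v ^+ 2) - 1.
have g2 v : 0 <= 1 - g v ^+ 2.
  by rewrite subr_ge0 -real_normK ?num_real// expr_le1.
have s2 v : s v ^+ 2 + g v ^+ 2 + s v + s v = 0.
  by rewrite /s; have := sqr_sqrtr (g2 v); move: (Num.sqrt _) => q; nra.
(* This comparison is what makes w vanish at infinity. *)
have sg v : `|s v| <= `|g v|.
  have q0 := sqrtr_ge0 (1 - g v ^+ 2).
  have : `|g v| ^+ 2 = g v ^+ 2 by rewrite real_normK ?num_real.
  have := sqr_sqrtr (g2 v); have := g1 v; have := normr_ge0 (g v).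
  have s0 : s v <= 0 by rewrite subr_le0 -[leRHS]sqrtr1 ler_sqrt// gerBl sqr_ge0.
  rewrite (ler0_norm s0) /s.
  move: (Num.sqrt _) (`|g v|) q0 => q a; nra.
have cabsNi : cabs (- 'i : C) = 1 by rewrite /cabs normrN; exact: cabs_i.
pose w : vertex E -> C := fun v => rc (s v) - 'i * rc (g v).
have cw : C0 w.
  apply: (C0_le (K := 2) hg) => v; rewrite /w.
  apply: le_trans (cabsD _ _) _; rewrite -mulNr cabsM !cabs_rc cabsNi.
  by have := sg v; lra.
have cw' := C0_conj cw.
have wc v : (w v)^* = rc (s v) + 'i * rc (g v).
  by rewrite /w rmorphB rmorphM /= !rc_conj conjCi mulNr opprK.
have Tw : nrm (T0 w) <= 2.
  apply: nrm_isometry; rewrite -(C0_star_hom_star hT0)// -(C0_star_hom_mul hT0)//.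
  have cww : C0 ((fun v => (w v)^*) \* w).
    apply: (C0_le (K := 2) cw) => v; rewrite /= cabsM cabs_conj ler_wpM2r ?cabs_ge0//.
    rewrite /w; apply: le_trans (cabsD _ _) _; rewrite -mulNr cabsM !cabs_rc cabsNi.
    by have := sg v; have := g1 v; lra.
  rewrite -!C0_homD//; last exact: C0D.
  rewrite -[RHS]C0_hom0; congr (T0 _); apply/funext => v.
  apply/eqP; rewrite eq_complex /=; apply/andP; split; apply/eqP; last by ring.
  by rewrite -[RHS](s2 v); ring.
have : nrm (T0 ((fun v => (w v)^*) + (-1) *: w)) <= 4.
  rewrite C0_homD//; last exact: C0Z.
  rewrite C0_homZ// scaleN1r (C0_star_hom_star hT0)//.
  by apply: le_trans (nrmD _ _) _; rewrite nrmN nrm_star; lra.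
have -> : (fun v => (w v)^*) + (-1) *: w = (rc 2 * 'i) *: (fun v => rc (g v)).
  apply/funext => v; apply/eqP; rewrite eq_complex /=.
  by apply/andP; split; apply/eqP; ring.
rewrite C0_homZ// nrmZ cabsM cabs_i cabs_rc ger0_norm; lra.
Qed.

(** After scaling to M = 1, the C*-identity gives |T0 h|^2 = |T0(|h|^2)|, which the real case bounds
    by 2; hence |T0 h| is at most 2. *)
Lemma C0_hom_bounded f (M : R) : C0 f -> 0 < M -> (forall v, cabs (f v) <= M) ->
  nrm (T0 f) <= 2 * M.
Proof.
suff scaled h : C0 h -> (forall v, cabs (h v) <= 1) -> nrm (T0 h) <= 2.
  move=> hf M0 fM.
  have Mf : C0 ((rc M^-1 : C) *: f) by exact: C0Z.
  have := scaled _ Mf; rewrite C0_homZ// nrmZ cabs_rc gtr0_norm ?invr_gt0//.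
  rewrite ler_pdivrMl// mulrC; apply=> v.
  rewrite [_ v]/(rc M^-1 * f v) cabsM cabs_rc gtr0_norm ?invr_gt0//.
  by rewrite ler_pdivrMl// mulr1.
move=> hh h1; pose g v := cabs (h v) ^+ 2.
have gE v : rc (g v) = (h v)^* * h v by rewrite rcX2 -cabsE normCK mulrC.
have g1 v : `|g v| <= 1.
  by rewrite ger0_norm ?sqr_ge0// expr_le1// cabs_ge0.
have hg : C0 (fun v => rc (g v) : C).
  apply: (C0_le (K := 1) hh) => v; rewrite gE cabsM cabs_conj ler_wpM2r ?cabs_ge0//.
have := C0_hom_real_bounded hg g1.
rewrite (_ : (fun v => _) = (fun v => (h v)^*) \* h); last exact/funext.
rewrite (C0_star_hom_mul hT0)//; last exact: C0_conj.
rewrite (C0_star_hom_star hT0)// nrm_star_mul; have := nrm_ge0 (T0 h); nra.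
Qed.

End DiscreteGraphAlgebra.

(** * The module of the finset graph *)

Section Unordered.
Context {R : realType}.
Local Notation C := (Cplx R).
Variable I : choiceType.

(** The net of finite partial sums is eventually constant. *)
Lemma sum_eventually (x : I -> C) (l : C) (F : {fset I}) :
  (forall B : {fset I}, (F `<=` B)%fset -> summability.partial_sum x B = l) ->
  summability.sum x = l.
Proof.
move=> h; rewrite /summability.sum.
have FF := @summability.totally_filter I.
apply: cvg_lim; first exact: norm_hausdorff.
by apply: cvg_near_cst; exists F => // B /h.
Qed.

Lemma sum_zero : summability.sum (fun _ : I => 0 : C) = 0.
Proof.
apply: (@sum_eventually _ _ fset0) => B _.
by rewrite /summability.partial_sum big1.
Qed.

Lemma sum_single (x : I -> C) (i0 : I) :
  (forall i, i != i0 -> x i = 0) -> summability.sum x = x i0.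
Proof.
move=> h; apply: (@sum_eventually _ _ [fset i0]%fset) => B.
rewrite fsub1set => Bi0; rewrite /summability.partial_sum.
rewrite (bigD1 [` Bi0]%fset)//= big1 ?addr0// => i ii0; apply: h.
by apply: contra ii0 => /eqP e; apply/eqP/val_inj.
Qed.

End Unordered.

Section FinsetGraphModule.
Context {R : realType} {X : choiceType}.
Local Notation C := (Cplx R).
Local Notation E := (finset_graph X).
Implicit Types (xi eta : edge E -> C) (v w : vertex E) (e : edge E).

Definition vdelta v : vertex E -> C := fun w => (w == v)%:R.
Definition edelta e : edge E -> C := fun e' => (e' == e)%:R.

Lemma C0_vdelta v : C0 (vdelta v).
Proof.
apply: (@C0_finite_support _ _ _ [fset v]%fset) => w; rewrite /vdelta inE.
by apply: contraR => /negbTE ->; apply/eqP.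
Qed.

(** Such an edge is a pair (x, v) with x in F and v a subset of F. Finiteness of the fibers of d and
    of the sets of bounded words both rest on this. *)
Lemma finite_edges_below (F : {fset X}) :
  finite_set [set e : edge E | (dmap e `<=` F)%fset].
Proof.
apply: (@sub_finite_set _ _ (val @^-1` ([set` F] `*` [set` fpowerset F]))).
  move=> [[x v] /= xv] vF; split=> /=; last by rewrite fpowersetE.
  exact: (fsubsetP vF).
apply: finite_preimage; first by move=> ? ? _ _; exact: val_inj.
exact: finite_setX.
Qed.

Lemma finite_dfiber v : finite_set (dfiber v).
Proof.
apply: sub_finite_set (finite_edges_below v) => e.
by rewrite /dfiber /= => ->.
Qed.

Lemma dfiber_esum xi v : (\esum_(e in dfiber v) (cabs (xi e) ^+ 2)%:E < +oo)%E.
Proof.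
rewrite esum_fset; first by rewrite fsumEFin ?ltry//; exact: finite_dfiber.
  exact: finite_dfiber.
by move=> e _; rewrite lee_fin sqr_ge0.
Qed.

Lemma CdP xi : Cd xi <-> C0 (inner xi xi).
Proof.
split=> [[]//|h]; split => //; first exact: discrete_continuous.
by move=> v; exact: dfiber_esum.
Qed.

Lemma inner_edelta e e' :
  inner (edelta e) (edelta e') = if e == e' then vdelta (dmap e) else 0.
Proof.
apply/funext => v; rewrite /inner.
have [ev|ev] := eqVneq (dmap e) v; last first.
  rewrite (_ : patch _ _ _ = fun=> 0).
    rewrite sum_zero; case: ifP => // _; rewrite /vdelta eq_sym.
    by rewrite (negbTE ev).
  apply/funext => f; rewrite patchE; case: ifPn => // /set_mem fv.
  rewrite /edelta; case: eqP => [fe|_]; last by rewrite conjC0 mul0r.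
  by move/eqP: ev; rewrite -fe.
rewrite (@sum_single _ _ _ e).
  rewrite patchE mem_set// /edelta eqxx conjC1 mul1r.
  by case: eqP => // _; rewrite /vdelta ev eqxx.
move=> f fe; rewrite patchE; case: ifP => // _.
by rewrite /edelta (negbTE fe) conjC0 mul0r.
Qed.

Lemma Cd_edelta e : Cd (edelta e).
Proof. by apply/CdP; rewrite inner_edelta eqxx; exact: C0_vdelta. Qed.

(** Edges are selected by their source, so whole fibers of d are kept or dropped and inner products
    are cut off in the same way. *)
Definition cutoff (K : pred (vertex E)) xi : edge E -> C :=
  fun e => if K (dmap e) then xi e else 0.

Lemma inner_cutoff (K : pred (vertex E)) xi v :
  inner (cutoff K xi) (cutoff K xi) v = if K v then inner xi xi v else 0.
Proof.
rewrite /inner; case: ifPn => Kv.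
  congr summability.sum; apply/funext => f; rewrite !patchE.
  by case: ifPn => // /set_mem fv; rewrite /cutoff fv Kv.
rewrite -[RHS](@sum_zero R (edge E)); congr summability.sum; apply/funext => f.
rewrite !patchE; case: ifPn => // /set_mem fv.
by rewrite /cutoff fv (negbTE Kv) mulr0.
Qed.

Lemma Cd_cutoff K xi : Cd xi -> Cd (cutoff K xi).
Proof.
move=> /CdP h; apply/CdP; apply: (C0_le (K := 1) h) => v.
by rewrite inner_cutoff mul1r; case: ifP => // _; rewrite cabs0 cabs_ge0.
Qed.

Lemma Cd_finite_support xi (F : {fset (edge E)}) :
  (forall e, xi e != 0 -> e \in F) -> Cd xi.
Proof.
move=> xiF; apply/CdP.
apply: (@C0_finite_support _ _ _ [fset dmap e | e in F]%fset) => v.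
apply: contraR => vF; apply/eqP; rewrite -[RHS](@sum_zero R (edge E)).
congr summability.sum; apply/funext => e; rewrite patchE.
case: ifPn => // /set_mem ev; have [->|/xiF eF] := eqVneq (xi e) 0.
  by rewrite mulr0.
by move/negP: vF; case; apply/imfsetP; exists e.
Qed.

End FinsetGraphModule.

(** * Words and matrix units *)

Section Words.
Context {R : realType} {X : choiceType}.
Local Notation C := (Cplx R).
Local Notation E := (finset_graph X).
Variables (O : cstarAlgType R) (t0 : (vertex E -> C) -> O) (t1 : (edge E -> C) -> O).
Hypothesis tP : toeplitz_pair t0 t1.
Implicit Types (u v w : vertex E) (e f : edge E) (mu nu k : seq (edge E)).

Let t0P := toeplitz_hom tP.

Definition vproj v : O := t0 (vdelta v).
Definition eiso e : O := t1 (edelta e).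

Lemma vprojM v w : cmul (vproj v) (vproj w) = if v == w then vproj v else 0.
Proof.
rewrite /vproj -(C0_star_hom_mul t0P); [|exact: C0_vdelta..].
rewrite -(C0_hom0 t0P) -(fun_if t0); congr t0; apply/funext => u.
rewrite /= /vdelta; have [->|uv] := eqVneq u v.
  by rewrite mul1r; case: eqP => [->|] //=; rewrite eqxx.
by rewrite mul0r; case: eqP => //= _; rewrite (negbTE uv).
Qed.

Lemma vproj_star v : cstar (vproj v) = vproj v.
Proof.
rewrite /vproj -(C0_star_hom_star t0P); last exact: C0_vdelta.
by congr t0; apply/funext => u; rewrite conjC_nat.
Qed.

Lemma eiso_starM e f :
  cmul (cstar (eiso e)) (eiso f) = if e == f then vproj (dmap e) else 0.
Proof.
rewrite /eiso (toeplitz_inner tP); [|exact: Cd_edelta..].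
by rewrite inner_edelta; case: ifP => // _; exact: C0_hom0.
Qed.

Lemma toeplitz_T10 : t1 0 = 0.
Proof.
apply: star_mul_eq0; have Cd0 : Cd (0 : edge E -> C).
  by apply: (@Cd_finite_support _ _ _ fset0) => e; rewrite eqxx.
rewrite (toeplitz_inner tP)//; rewrite -[RHS](C0_hom0 t0P); congr t0.
apply/funext => v; rewrite -[RHS](@sum_zero R (edge E)); congr summability.sum.
by apply/funext => e; rewrite patchE; case: ifP => // _; rewrite mulr0.
Qed.

Lemma vproj_eiso v e : cmul (vproj v) (eiso e) = if rmap e == v then eiso e else 0.
Proof.
rewrite (toeplitz_left tP); [|exact: C0_vdelta|exact: Cd_edelta].
rewrite -toeplitz_T10 -(fun_if t1); congr t1; apply/funext => f.
rewrite /pi_r /on_Cd patchE mem_set; last exact: Cd_edelta.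
rewrite /vdelta /edelta; have [->|fe] := eqVneq f e.
  by rewrite mulr1; case: eqP => //= _; rewrite eqxx.
by rewrite mulr0; case: eqP => //= _; rewrite (negbTE fe).
Qed.

(** The pair prescribes only the left action, so the right one is recovered from inner products: the
    square of s_e - s_e p expands to p - p - p + p = 0. *)
Lemma eiso_vproj e : cmul (eiso e) (vproj (dmap e)) = eiso e.
Proof.
apply/eqP; rewrite -subr_eq0; apply/eqP/star_mul_eq0.
rewrite cstarB cstarM vproj_star mulBc !cmulB -!cmulA.
rewrite (cmulA (cstar (eiso e)) (eiso e)) !eiso_starM eqxx.
by rewrite !(vprojM, eqxx, subrr).
Qed.

(** The product s_mu p_v for an arbitrary list of edges; lists that are not paths ending at v give
    0. *)
Definition word mu v : O := foldr (fun e x => cmul (eiso e) x) (vproj v) mu.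

Lemma vproj_word u mu v : cmul (vproj u) (word mu v) = word mu v \/
  cmul (vproj u) (word mu v) = 0.
Proof.
case: mu => [|e mu] /=.
  by rewrite vprojM; case: eqP => [->|_]; [left|right].
by rewrite cmulA vproj_eiso; case: eqP => _; [left|right; rewrite mul0c].
Qed.

Lemma wordM mu u nu v : cmul (vproj u) (word nu v) = word nu v ->
  cmul (word mu u) (word nu v) = word (mu ++ nu) v.
Proof. by move=> h; elim: mu => //= e mu ih; rewrite -cmulA ih. Qed.

(** First edges are compared: distinct ones give 0, equal ones cancel to a vertex projection, and
    when one list runs out the rest of the other survives. The side equations are those that [wordM]
    needs for concatenation. *)
Lemma word_starM mu u nu v :
  [\/ cmul (cstar (word mu u)) (word nu v) = 0,
      exists2 k, cmul (cstar (word mu u)) (word nu v) = word k v &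
        cmul (vproj u) (word k v) = word k v |
      exists2 k, cmul (cstar (word mu u)) (word nu v) = cstar (word k u) &
        cmul (vproj v) (word k u) = word k u].
Proof.
elim: mu nu => [|e mu ih] nu.
  rewrite /= vproj_star; have [h|h] := vproj_word u nu v.
    by apply: Or32; exists nu.
  exact: Or31.
case: nu => [|f nu].
  have [h|h] := vproj_word v (e :: mu) u.
    by apply: Or33; exists (e :: mu) => //; rewrite -{2}h cstarM vproj_star.
  by apply: Or31; rewrite -[word [::] v]/(vproj v) -vproj_star -cstarM h cstar0.
have -> : cmul (cstar (word (e :: mu) u)) (word (f :: nu) v) =
    cmul (cstar (word mu u)) (cmul (cmul (cstar (eiso e)) (eiso f)) (word nu v)).
  by rewrite /= cstarM !cmulA.
rewrite eiso_starM; case: eqP => _; last by apply: Or31; rewrite mul0c cmul0.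
have [->|->] := vproj_word (dmap e) nu v; first exact: ih.
by apply: Or31; rewrite cmul0.
Qed.

(* In a nonzero word the edges form a path along which a point is removed at
   each step; this bounds the number of words ending at a given vertex. *)
Lemma word_path mu v : word mu v <> 0 ->
  exists u, [/\ cmul (vproj u) (word mu v) = word mu v,
    (u `<=` v)%fset, (#|` u| + size mu)%N = #|` v| &
    forall e, e \in mu -> (dmap e `<=` v)%fset].
Proof.
elim: mu => [|e mu ih] h /=.
  by exists v; rewrite vprojM eqxx fsubset_refl addn0.
have [|u [uw uv su hmu]] := ih; first by move=> h0; apply: h; rewrite /= h0 cmul0.
have [de|de] := eqVneq (dmap e) u; last first.
  (* Inserting projections gives s_e p_{d(e)} p_u between the edge and the word, which is 0 when
     d(e) differs from u. *)
  by case: h; rewrite /= -uw -eiso_vproj cmulA -(cmulA (eiso e)) vprojM (negbTE de)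
    cmul0 mul0c.
have ev : (dmap e `<=` v)%fset by rewrite de.
have re : (rmap e `<=` dmap e)%fset by exact: fsubD1set.
exists (rmap e); split.
- by rewrite cmulA vproj_eiso eqxx.
- exact: fsubset_trans re ev.
(* The range has exactly one point fewer than the source while the word is one edge longer, so the
   sum is unchanged. *)
- rewrite addnS -su -de.
  have -> : #|` (dmap e : {fset X}) | = #|` (rmap e : {fset X}) |.+1.
    by rewrite (cardfsD1 (val e).1) (valP e) add1n.
  by rewrite addSn.
- by move=> f; rewrite inE => /predU1P [->|/hmu].
Qed.

(** A finite superset of the words needed, closed under prepending edges rather than restricted to
    paths; 0 is included to absorb the degenerate words. *)
Fixpoint bounded_words (F : {fset X}) n : set O :=
  if n is m.+1 then
    bounded_words F m `|` [set cmul (eiso e) x |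
      e in [set e : edge E | (dmap e `<=` F)%fset] & x in bounded_words F m]
  else [set 0] `|` vproj @` [set` fpowerset F].

Lemma finite_bounded_words F n : finite_set (bounded_words F n).
Proof.
elim: n => [|n ih] /=; rewrite finite_setU; split => //.
  exact: finite_image.
by apply: finite_image2 => //; exact: finite_edges_below.
Qed.

Lemma word_bounded F n mu v : (v `<=` F)%fset -> (size mu <= n)%N ->
  (forall e, e \in mu -> (dmap e `<=` F)%fset) -> bounded_words F n (word mu v).
Proof.
move=> vF; elim: n mu => [|n ih] [|e mu] //= smu hmu.
- by right; exists v => //=; rewrite fpowersetE.
- by left; exact: (ih [::]).
- right; exists e; first by apply: hmu; rewrite inE eqxx.
  exists (word mu v) => //; apply: ih => // f fmu.
  by apply: hmu; rewrite inE fmu orbT.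
Qed.

Lemma bounded_words0 F n : bounded_words F n 0.
Proof. by elim: n => [|n ih]; left. Qed.

(** By [word_path] a nonzero word has length |v| - |u|, which is at most |F|. *)
Lemma word_bounded_card F mu v : (v `<=` F)%fset -> bounded_words F #|` F| (word mu v).
Proof.
move=> vF; have [->|/word_path [u [_ _ su hmu]]] := pselect (word mu v = 0).
  exact: bounded_words0.
apply: word_bounded => //.
  by rewrite (leq_trans (leq_addl #|` u| _))// su; exact: fsubset_leq_card.
by move=> e /hmu ev; exact: fsubset_trans ev vF.
Qed.

Definition matrix_units (F : {fset X}) : set O :=
  [set x | exists mu nu v, (v `<=` F)%fset /\ x = cmul (word mu v) (cstar (word nu v))].

Lemma finite_matrix_units F : finite_set (matrix_units F).
Proof.
apply: (@sub_finite_set _ _ [set cmul x (cstar y) |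
  x in bounded_words F #|` F| & y in bounded_words F #|` F|]).
  move=> x [mu [nu [v [vF ->]]]].
  exists (word mu v); first exact: word_bounded_card.
  by exists (word nu v) => //; exact: word_bounded_card.
by apply: finite_image2; exact: finite_bounded_words.
Qed.

(** The inner adjoint-times-word collapses by [word_starM] to a word or the adjoint of one, which is
    absorbed on the left or on the right; the resulting vertex is v or u, still contained in F. *)
Lemma matrix_unitsM F x y : matrix_units F x -> matrix_units F y ->
  cmul x y = 0 \/ matrix_units F (cmul x y).
Proof.
move=> [a [b [u [uF ->]]]] [c [d [v [vF ->]]]].
rewrite cmulA -(cmulA (word a u)).
have [->|[k -> h]|[k -> h]] := word_starM b u c v.
- by left; rewrite cmul0 mul0c.
- by right; exists (a ++ k), d, v; rewrite wordM.
- by right; exists a, (d ++ k), u; rewrite -cmulA -cstarM wordM.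
Qed.

Lemma matrix_units_star F x : matrix_units F x -> matrix_units F (cstar x).
Proof.
move=> [a [b [u [uF ->]]]]; exists b, a, u; split => //.
by rewrite cstarM cstarK.
Qed.

Lemma matrix_units_seq_exists F : exists D : seq O, matrix_units F = [set` D].
Proof. exact/finite_seqP/finite_matrix_units. Qed.

Definition matrix_units_seq F := projT1 (cid (matrix_units_seq_exists F)).

Lemma matrix_units_seqP F x : reflect (matrix_units F x) (x \in matrix_units_seq F).
Proof.
rewrite /matrix_units_seq; case: cid => D /= ->; exact: idP.
Qed.

Lemma level_star_subalgebra F : star_subalgebra (span (matrix_units_seq F)).
Proof.
apply: span_star_subalgebra => [x y /matrix_units_seqP hx /matrix_units_seqP hy|x].
  have [->|h] := matrix_unitsM hx hy; first exact: span0.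
  exact/span_mem/matrix_units_seqP.
by move=> /matrix_units_seqP /matrix_units_star h; exact/span_mem/matrix_units_seqP.
Qed.

Definition level F : closed_subalgebra O :=
  ClosedSubalgebra (@span_closed _ _ (matrix_units_seq F)) (level_star_subalgebra F).

Lemma level_mono F G : (F `<=` G)%fset -> csub_set (level F) `<=` csub_set (level G).
Proof.
move=> FG; apply: span_sub => x /matrix_units_seqP [mu [nu [v [vF ->]]]].
by apply/matrix_units_seqP; exists mu, nu, v; split=> //; exact: fsubset_trans FG.
Qed.

Lemma level_vproj v : csub_set (level v) (vproj v).
Proof.
apply/span_mem/matrix_units_seqP; exists [::], [::], v.
by rewrite fsubset_refl /= vproj_star vprojM eqxx.
Qed.

Lemma level_eiso e : csub_set (level (dmap e)) (eiso e).
Proof.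
apply/span_mem/matrix_units_seqP; exists [:: e], [::], (dmap e).
by rewrite fsubset_refl /= vproj_star eiso_vproj eiso_vproj.
Qed.

End Words.

(** * Density of the union of the finite dimensional levels *)

Section Density.
Context {R : realType}.
Local Notation C := (Cplx R).

(** The norm closure of U, phrased with real tolerances. *)
Definition approx (A : cstarAlgType R) (U : set A) : set A :=
  [set x | forall e : R, 0 < e -> exists2 a, U a & nrm (x - a) < e].

Lemma approx_closed (A : cstarAlgType R) (U : set A) : closed (approx U).
Proof.
apply/cstar_closedP => x h e e0; have e2 : 0 < e / 2 by rewrite divr_gt0.
have [y hy xy] := h _ e2; have [a Ua ya] := hy _ e2.
by exists a => //; have := nrm_dist y x a; lra.
Qed.

Lemma sub_approx (A : cstarAlgType R) (U : set A) : U `<=` approx U.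
Proof. by move=> x Ux e e0; exists x; rewrite ?subrr ?nrm0. Qed.

Lemma approx_star_subalgebra (A : cstarAlgType R) (U : set A) :
  star_subalgebra U -> star_subalgebra (approx U).
Proof.
move=> hU; split=> [|a x y hx hy e e0|x y hx hy e e0|x hx e e0].
- exact: (sub_approx (star_subalgebra0 hU)).
- have e2 : 0 < e / 2 by rewrite divr_gt0.
  have a1 : 0 < cabs a + 1 by have := cabs_ge0 a; lra.
  have [x' Ux' xx'] := hx _ (divr_gt0 e2 a1); have [y' Uy' yy'] := hy _ e2.
  exists (a *: x' + y'); first exact: star_subalgebra_linear.
  have -> : a *: x + y - (a *: x' + y') = a *: (x - x') + (y - y').
    by rewrite scalerBr opprD addrACA.
  move: xx'; rewrite (ltr_pdivlMr _ _ a1) => xx'.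
  have := nrmD (a *: (x - x')) (y - y'); rewrite nrmZ.
  by have := nrm_ge0 (x - x'); lra.
- have e2 : 0 < e / 2 by rewrite divr_gt0.
  have x1 : 0 < nrm x + 1 by have := nrm_ge0 x; lra.
  (* y' is chosen first, since the tolerance for x' depends on the norm of y' in [nrm_mul_dist]. *)
  have [y' Uy' yy'] := hy _ (divr_gt0 e2 x1).
  have y1 : 0 < nrm y' + 1 by have := nrm_ge0 y'; lra.
  have [x' Ux' xx'] := hx _ (divr_gt0 e2 y1).
  exists (cmul x' y'); first exact: star_subalgebra_mul.
  move: xx' yy'; rewrite (ltr_pdivlMr _ _ y1) (ltr_pdivlMr _ _ x1) => xx' yy'.
  have := nrm_mul_dist x y x' y'.
  by have := nrm_ge0 (x - x'); have := nrm_ge0 (y - y'); lra.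
- have [x' Ux' xx'] := hx e e0; exists (cstar x'); first exact: star_subalgebra_star.
  by rewrite -cstarB nrm_star.
Qed.

Section Graph.
Variable X : choiceType.
Local Notation E := (finset_graph X).
Variables (O : cstarAlgType R) (t0 : (vertex E -> C) -> O) (t1 : (edge E -> C) -> O).
Hypothesis tP : toeplitz_pair t0 t1.
Let t0P := toeplitz_hom tP.

Definition levels : set O := [set x | exists F, csub_set (level tP F) x].

Lemma levels2 x y : levels x -> levels y ->
  exists F, csub_set (level tP F) x /\ csub_set (level tP F) y.
Proof.
move=> [F Fx] [G Gy]; exists (F `|` G)%fset.
by split; [apply: level_mono Fx; exact: fsubsetUl|apply: level_mono Gy; exact: fsubsetUr].
Qed.

Lemma levels_star_subalgebra : star_subalgebra levels.
Proof.
split=> [|a x y hx hy|x y hx hy|x [F hx]].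
- by exists fset0; exact: star_subalgebra0 (level_star_subalgebra tP _).
- have [F [Fx Fy]] := levels2 hx hy; exists F.
  exact: star_subalgebra_linear (level_star_subalgebra tP F) _ _ _ Fx Fy.
- have [F [Fx Fy]] := levels2 hx hy; exists F.
  exact: star_subalgebra_mul (level_star_subalgebra tP F) _ _ Fx Fy.
- by exists F; exact: star_subalgebra_star (level_star_subalgebra tP F) _ hx.
Qed.

Lemma levels_T0_finite (s : seq (vertex E)) (f : vertex E -> C) :
  (forall v, f v != 0 -> v \in s) -> levels (t0 f).
Proof.
elim: s f => [|v s ih] f fs.
  rewrite (_ : f = 0); last first.
    by apply/funext => v; apply/eqP; apply: contraT => /fs.
  rewrite (C0_hom0 t0P); exact: star_subalgebra0 levels_star_subalgebra.
pose g : vertex E -> C := fun w => if w == v then 0 else f w.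
have gs w : g w != 0 -> w \in s.
  rewrite /g; have [_|wv fw] := eqVneq w v; first by move=> /eqP.
  by have := fs w fw; rewrite inE (negbTE wv).
have -> : f = f v *: vdelta v + g.
  apply/funext => w; rewrite [RHS]/(f v * vdelta v w + g w) /vdelta /g.
  have [->|wv] := eqVneq w v; first by rewrite mulr1; exact/esym/addr0.
  by rewrite mulr0; exact/esym/add0r.
rewrite (C0_star_hom_linear t0P); first last.
- by apply: (@C0_finite_support _ _ _ [fset w in s]%fset) => w /gs; rewrite inE.
- exact: C0_vdelta.
apply: star_subalgebra_linear levels_star_subalgebra _ _ _ _ (ih _ gs).
by exists v; exact: level_vproj.
Qed.

Lemma levels_T1_finite (s : seq (edge E)) (xi : edge E -> C) :
  (forall e, xi e != 0 -> e \in s) -> levels (t1 xi).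
Proof.
elim: s xi => [|e s ih] xi xis.
  rewrite (_ : xi = 0); last first.
    by apply/funext => e; apply/eqP; apply: contraT => /xis.
  rewrite (toeplitz_T10 tP); exact: star_subalgebra0 levels_star_subalgebra.
pose eta : edge E -> C := fun f => if f == e then 0 else xi f.
have etas f : eta f != 0 -> f \in s.
  rewrite /eta; have [_|fe xif] := eqVneq f e; first by move=> /eqP.
  by have := xis f xif; rewrite inE (negbTE fe).
have -> : xi = xi e *: edelta e + eta.
  apply/funext => f; rewrite [RHS]/(xi e * edelta e f + eta f) /edelta /eta.
  have [->|fe] := eqVneq f e; first by rewrite mulr1; exact/esym/addr0.
  by rewrite mulr0; exact/esym/add0r.
rewrite (toeplitz_linear tP); first last.
- by apply: (@Cd_finite_support _ _ _ [fset f in s]%fset) => f /etas; rewrite inE.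
- exact: Cd_edelta.
apply: star_subalgebra_linear levels_star_subalgebra _ _ _ _ (ih _ etas).
by exists (dmap e); exact: level_eiso.
Qed.

(** Truncate f to the finite set where it is at least e / 4 in modulus; boundedness of t0 makes the
    image of the remainder at most e / 2. *)
Lemma approx_T0 f : C0 f -> approx levels (t0 f).
Proof.
move=> hf e e0; have e4 : 0 < e / 4 by rewrite divr_gt0.
have /finite_seqP [s sE] := (discrete_C0P f).1 hf _ e4.
pose g : vertex E -> C := fun v => if v \in s then f v else 0.
have gs v : g v != 0 -> v \in s by rewrite /g; case: ifP => // _ /eqP.
have hg : C0 g.
  apply: (C0_le (K := 1) hf) => v; rewrite mul1r /g.
  by case: ifP => // _; rewrite cabs0 cabs_ge0.
exists (t0 g); first exact: levels_T0_finite gs.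
have -> : t0 f - t0 g = t0 ((-1) *: g + f).
  by rewrite (C0_star_hom_linear t0P)// scaleN1r addrC.
have : nrm (t0 ((-1) *: g + f)) <= 2 * (e / 4); last lra.
apply: C0_hom_bounded => //; first by apply: C0D => //; exact: C0Z.
have gE (v : vertex E) : ((-1) *: g + f) v = if v \in s then 0 else f v.
  rewrite [LHS]/(-1 * g v + f v) /g; case: ifP => _.
    by rewrite mulN1r; exact: addNr.
  by rewrite mulr0; exact: add0r.
move=> v; rewrite gE; case: ifPn => vs; first by rewrite cabs0 ltW.
rewrite leNgt; apply/negP => /ltW fv.
by move/negP: vs; apply; have : [set` s] v by rewrite -sE.
Qed.

(** Cut off to the finitely many vertices where the inner square is at least e^2 / 4. Finiteness of
    the fibers makes the cutoff finitely supported, and the remainder eta satisfies |t1(eta)|^2 =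
    |t0(<eta, eta>)|, at most e^2 / 2. *)
Lemma approx_T1 xi : Cd xi -> approx levels (t1 xi).
Proof.
move=> hxi e e0; have e4 : 0 < e ^+ 2 / 4 by rewrite divr_gt0// exprn_gt0.
have hin := (CdP xi).1 hxi.
have /finite_seqP [s sE] := (discrete_C0P (inner xi xi)).1 hin _ e4.
pose K : pred (vertex E) := fun v => v \in s.
have hK := Cd_cutoff K hxi; have hK' := Cd_cutoff (predC K) hxi.
have /finite_seqP [es esE] : finite_set [set e : edge E | dmap e \in s].
  rewrite (_ : [set _ | _] = bigcup [set` s] (fun v : vertex E => @dfiber E v)).
    by apply: bigcup_finite => // v _; exact: finite_dfiber.
  apply/seteqP; split=> [f fs|f [v vs fv]]; first by exists (dmap f).
  by have -> : [set e : edge E | dmap e \in s] f = (v \in s) by rewrite -fv.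
exists (t1 (cutoff K xi)).
  apply: (@levels_T1_finite es) => f; rewrite /cutoff.
  case: ifP => [fs _|_]; last by move=> /eqP.
  by have : [set` es] f by rewrite -esE.
have -> : t1 xi - t1 (cutoff K xi) = t1 (cutoff (predC K) xi).
  apply/eqP; rewrite subr_eq; apply/eqP.
  have := toeplitz_linear tP 1 hK' hK; rewrite !scale1r => <-.
  congr t1; apply/funext => f.
  rewrite [RHS]/(cutoff (predC K) xi f + cutoff K xi f) /cutoff /=.
  by case: (K _); [exact/esym/add0r|exact/esym/addr0].
rewrite -(ltr_pXn2r (n := 2)) ?nnegrE ?nrm_ge0 ?ltW// -nrm_star_mul.
rewrite (toeplitz_inner tP)//.
have : nrm (t0 (inner (cutoff (predC K) xi) (cutoff (predC K) xi)))
    <= 2 * (e ^+ 2 / 4); last lra.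
apply: C0_hom_bounded => //; first exact/CdP.
move=> v; rewrite inner_cutoff /=; case: ifPn => vs; last by rewrite cabs0 ltW.
rewrite leNgt; apply/negP => /ltW fv.
by move/negP: vs; apply; have : [set` s] v by rewrite -sE.
Qed.

(** The closure of the union is a closed star subalgebra containing the images of t0 and t1, hence
    everything by generation. *)
Lemma levels_dense : generated_by t0 t1 -> forall (x : O) (e : R), 0 < e ->
  exists (F : {fset X}) (a : csub (level tP F)), nrm (x - val a) < e.
Proof.
move=> gen x e e0.
have : approx levels x.
  rewrite (gen _ (@approx_closed _ levels))//.
  - exact/approx_star_subalgebra/levels_star_subalgebra.
  - exact: approx_T0.
  - exact: approx_T1.
move=> /(_ e e0) [a [F Fa] xa]; exists F.
have Fa' : csub_pred (level tP F) a by apply/asboolP.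
by exists (exist _ a Fa').
Qed.

End Graph.
End Density.

Theorem proposition13p7 (R : realType) (X : choiceType)
    (hX : ~ countable [set: X]) (O : cstarAlgType R)
    (t0 : (vertex (finset_graph X) -> Cplx R) -> O)
    (t1 : (edge (finset_graph X) -> Cplx R) -> O)
    (hO : graph_cstar_algebra t0 t1) :
  exists S : directed_system R,
    (forall i : dsys_index S, finite_dimensional (S i)) /\
    inductive_limit S O.
Proof.
have tP := (graph_algebra_pair hO).1.
have directed (F G : {fset X}) : exists H : {fset X}, (F `<=` H)%fset /\ (G `<=` H)%fset.
  by exists (F `|` G)%fset; rewrite fsubsetUl fsubsetUr.
(* The index set consists of the finite subsets of X under inclusion, directed by unions. *)
exists (@union_system _ _ {fset X} (fun F G => is_true (F `<=` G)%fset)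
  (inhabits fset0) (@fsubset_refl X)
  (fun F G H => @fsubset_trans _ G F H) directed (level tP) (@level_mono _ _ _ _ _ tP)).
split.
  by move=> F; exact: csub_span_finite_dimensional.
apply: union_inductive_limit; exact: levels_dense (graph_algebra_generated hO).
Qed.
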